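(* Let $n\ge1$. The set $$\mathfrak{B}^{JW}_n:=\{f(T)\ ;\ T\text{ is a Riordan tree of order } n\}$$ forms a basis for $\mathrm{Inv}_{U_q}(V_2^{\otimes n})$.
   Context: Quantum group. $U_q=U_q(sl_2)$ is the $\mathbb{C}(q)$-algebra generated by $K,K^{-1},E,F$ with $KK^{-1}=K^{-1}K=1$, $KE=q^2EK$, $KF=q^{-2}FK$, $EF-FE=\frac{K-K^{-1}}{q-q^{-1}}$. Let $[m]=(q^m-q^{-m})/(q-q^{-1})$. For $m\ge0$, $V_m$ is the $(m+1)$-dimensional irreducible representation with basis $v_i$ ($-m\le i\le m$, $i\equiv m$ mod $2$) and $Ev_i=[\frac{m+i+2}{2}]v_{i+2}$, $Fv_i=[\frac{m-i+2}{2}]v_{i-2}$, $K^{\pm1}v_i=q^{\pm i}v_i$ (with $v_{m+2}=v_{-m-2}=0$). Dual basis vectors: in $V_1$, $v^{\pm1}=v_{\pm1}$; in $V_2$, $v^2=v_2$, $v^0=\frac1{[2]}v_0$, $v^{-2}=v_{-2}$. $U_q$ acts on tensor products via $\bar\Delta(K)=K\otimes K$, $\bar\Delta(E)=E\otimes1+K^{-1}\otimes E$, $\bar\Delta(F)=F\otimes K+1\otimes F$. $\mathrm{Inv}_{U_q}(V_2^{\otimes n})$ is the $\mathbb{C}(q)$-space of $x\in V_2^{\otimes n}$ with $Ex=Fx=0$, $Kx=x$. Define $\delta_1\colon\mathbb{C}(q)\to V_1\otimes V_1$ by $\delta_1(1)=v^1\otimes v^{-1}-q^{-1}v^{-1}\otimes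 v^1$, and $\pi_2\colon V_1\otimes V_1\to V_2$ by $\pi_2(v^1\otimes v^1)=v^2$, $\pi_2(v^{-1}\otimes v^{-1})=v^{-2}$, $\pi_2(v^1\otimes v^{-1})=q^{-1}v^0$, $\pi_2(v^{-1}\otimes v^1)=v^0$. The Jones–Wenzl projector $p_2\colon V_1\otimes V_1\to V_1\otimes V_1$ is given by $p_2(v^{1}\otimes v^{1})=v^1\otimes v^1$, $p_2(v^{-1}\otimes v^{-1})=v^{-1}\otimes v^{-1}$, $p_2(v^1\otimes v^{-1})=\frac1{[2]}(q^{-1}v^1\otimes v^{-1}+v^{-1}\otimes v^1)$, $p_2(v^{-1}\otimes v^1)=\frac1{[2]}(v^1\otimes v^{-1}+qv^{-1}\otimes v^1)$. Equivalently $p_2=\mathrm{id}+\frac1{[2]}\delta_1\circ\varepsilon_1$, where $\varepsilon_1\colon V_1\otimes V_1\to\mathbb{C}(q)$ has $\varepsilon_1(v^1\otimes v^{-1})=-q$, $\varepsilon_1(v^{-1}\otimes v^1)=1$, $\varepsilon_1(v^{\pm1}\otimes v^{\pm1})=0$. Riordan trees. A Riordan partition of $\{1,\ldots,n\}$ is a partition into parts each containing at least two elements and whose convex hulls are disjoint when $1,\ldots,n$ are arranged in order on a circle. An ordered linear tree with labels $j_1<\cdots<j_k$ ($k\ge2$) is a single edge with endpoints $j_1,j_2$ if $k=2$, and otherwise a path from a univalent vertex labeled $j_1$ to one labeled $j_k$ through trivalent vertices $t_2,\ldots,t_{k-1}$, with a leg labeled $j_a$ attached at $t_a$; its internal edges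 are the $k-3$ edges $t_at_{a+1}$, $2\le a\le k-2$ (none if $k\le 3$). A Riordan tree of order $n$ is a disjoint union of ordered linear trees whose label sets form a Riordan partition of $\{1,\ldots,n\}$. The element $f^0$. Let $\mathcal{P}$ be a non-crossing partition of $\{1,\ldots,n\}$. Place $2n$ points $1,\ldots,2n$ on a line (points $2j-1,2j$ belong to box $j$, a copy of $V_2$). For each part $\{j_1<\cdots<j_k\}$ of $\mathcal{P}$ draw arcs in the lower half-plane joining point $2j_a$ to $2j_{a+1}-1$ ($1\le a\le k-1$) and $2j_1-1$ to $2j_k$. This is the boundary of a neighborhood of the tree embedded in the lower half-plane with its $j$-labeled vertex at box $j$. Let $u_{\mathcal{P}}\in V_1^{\otimes 2n}$ be the tensor obtained by associating $\delta_1$ to each arc (left end in the first factor): $u_{\mathcal{P}}=\sum_s\big(\prod_{\text{arcs }(a<b)}w(s_a,s_b)\big)v^{s_1}\otimes\cdots\otimes v^{s_{2n}}$, where $s\in\{\pm1\}^{2n}$, $w(1,-1)=1$, $w(-1,1)=-q^{-1}$, $w(1,1)=w(-1,-1)=0$. Put $f^0(\mathcal{P})=\pi_2^{\otimes n}(u_{\mathcal{P}})$ (which is $0$ if $\mathcal{P}$ has a singleton part). For a Riordan tree $T$ with associated Riordan partition $\mathcal{P}_T$, $f^0(T):=f^0(\mathcal{P}_T)$. The element $f(T)$. It is obtained from the diagram of $f^0(T)$ by inserting a copy of $p_2$ in the pair of arcs running along each internal edge of $T$. Explicitly, $f(T)=\sum_{E}[2]^{-|E|}f^0(\mathcal{P}_{T\setminus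 E})$, where $E$ runs over all subsets of the set of internal edges of $T$ and $\mathcal{P}_{T\setminus E}$ is the partition of $\{1,\ldots,n\}$ given by the labels of the connected components of $T$ after removing the edges in $E$. *)

(* Defs.v *)
From HB Require Import structures.
From mathcomp Require Import all_boot all_order all_algebra.
From mathcomp Require Import classical_sets boolp reals complex.

Set Implicit Arguments.
Unset Strict Implicit.
Unset Printing Implicit Defensive.

Import Order.TTheory GRing.Theory Num.Theory.

Local Open Scope ring_scope.

Notation Cq R := {fraction {poly R[i]}}.
Definition qvar (R : realType) : Cq R := tofrac 'X.

(** * The modules V_m, their tensor powers, and invariants

    Everything up to the element f(T) is written over a field [k] with a
    parameter [q]; the theorem takes [k] to be C(q). *)

Section QuantumGroup.
Variables (k : fieldType) (q : k).

Definition qint (m : nat) : k := (q ^+ m - q ^- m) / (q - q^-1).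

(** The index [a : 'I_m.+1] stands for the weight i = 2a - m, so that
    (m+i+2)/2 = a + 1 and (m-i+2)/2 = m - a + 1.  The matrices act on column
    vectors: column [a] is the image of the basis vector of index [a]. *)
Definition opE m : 'M[k]_m.+1 :=
  \matrix_(b, a) (if b == a.+1 :> nat then qint a.+1 else 0).
Definition opF m : 'M[k]_m.+1 :=
  \matrix_(b, a) (if b.+1 == a :> nat then qint (m - a).+1 else 0).
Definition opK m : 'M[k]_m.+1 :=
  \matrix_(b, a) (if b == a then q ^ ((a.*2)%:Z - m%:Z) else 0).
Definition opKinv m : 'M[k]_m.+1 :=
  \matrix_(b, a) (if b == a then q ^ (- ((a.*2)%:Z - m%:Z)) else 0).

(** [x t] is the coefficient of v_{t_1} (x) ... (x) v_{t_n} in [x], an element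
    of the n-th tensor power of V_m. *)
Definition tens m n := {ffun n.-tuple 'I_m.+1 -> k^o}.

(** The operator A (x) B on V_m (x) (V_m)^(x)n. *)
Definition tens_op m n (A : 'M[k]_m.+1) (B : tens m n -> tens m n)
    (x : tens m n.+1) : tens m n.+1 :=
  [ffun t : n.+1.-tuple 'I_m.+1 =>
    \sum_(a < m.+1)
      A (thead t) a *
      (B [ffun s : n.-tuple 'I_m.+1 => x [tuple of a :: s]]) [tuple of behead t]].

(** The action through the iterated coproduct
      K |-> K (x) K,  E |-> E (x) 1 + K^-1 (x) E,  F |-> F (x) K + 1 (x) F,
    and through the counit for n = 0. *)
Fixpoint actK m n : tens m n -> tens m n :=
  if n is _.+1 then tens_op (opK m) (@actK m _) else id.

Fixpoint actKinv m n : tens m n -> tens m n :=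
  if n is _.+1 then tens_op (opKinv m) (@actKinv m _) else id.

Fixpoint actE m n : tens m n -> tens m n :=
  if n is _.+1 then
    fun x => tens_op (opE m) id x + tens_op (opKinv m) (@actE m _) x
  else fun=> 0.

Fixpoint actF m n : tens m n -> tens m n :=
  if n is _.+1 then
    fun x => tens_op (opF m) (@actK m _) x + tens_op 1%:M (@actF m _) x
  else fun=> 0.

Definition Inv n : set (tens 2 n) :=
  [set x | [/\ actE x = 0, actF x = 0 & actK x = x]]%classic.

(** * The element f^0 of a partition *)

(** Coefficient of v^a (x) v^b in delta_1(1); in V_1, index 1 is v^1 and index
    0 is v^{-1}. *)
Definition delta1 (a b : 'I_2) : k :=
  match nat_of_ord a, nat_of_ord b with
  | 1%N, 0%N => 1
  | 0%N, 1%N => - q^-1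
  | _, _ => 0
  end.

Definition V2basis (c : 'I_3) : 'cV[k]_3 := delta_mx c 0.

(** The dual basis vectors v^{-2}, v^0, v^2 have index 0, 1, 2. *)
Definition V2dual (c : 'I_3) : 'cV[k]_3 :=
  if c == 1 :> nat then (qint 2)^-1 *: V2basis c else V2basis c.

(** pi_2(v^a (x) v^b). *)
Definition pi2 (a b : 'I_2) : 'cV[k]_3 :=
  match nat_of_ord a, nat_of_ord b with
  | 1%N, 1%N => V2dual (inord 2)
  | 0%N, 0%N => V2dual (inord 0)
  | 1%N, 0%N => q^-1 *: V2dual (inord 1)
  | _, _ => V2dual (inord 1)
  end.

Definition pi2_tens n (u : tens 1 n.*2) : tens 2 n :=
  [ffun t : n.-tuple 'I_3 =>
    \sum_(s : n.*2.-tuple 'I_2)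
      u s * \prod_(j < n)
        pi2 (nth ord0 s j.*2) (nth ord0 s j.*2.+1) (tnth t j) 0].

(** Labels and points are numbered from 0: box j carries the points 2j and
    2j + 1.  [enum B] lists the part [B] in increasing order. *)
Definition arcs n (B : {set 'I_n}) : seq (nat * nat) :=
  let l := [seq nat_of_ord j | j <- enum B] in
  ((head 0%N l).*2, (last 0%N l).*2.+1)
    :: [seq (p.1.*2.+1, p.2.*2) | p <- zip l (behead l)].

Definition uP n (P : {set {set 'I_n}}) : tens 1 n.*2 :=
  [ffun s : n.*2.-tuple 'I_2 =>
    \prod_(B in P) \prod_(p <- arcs B) delta1 (nth ord0 s p.1) (nth ord0 s p.2)].

Definition f0 n (P : {set {set 'I_n}}) : tens 2 n := pi2_tens (uP P).

End QuantumGroup.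

Arguments Inv [k] q n _.

(** * Riordan partitions *)

(** The points of index 0, 1, 2, ... occur in this order counterclockwise on
    the unit circle (stereographic parametrization). *)
Definition circle_pt (R : realType) (j : nat) : R * R :=
  ((1 - j%:R ^+ 2) / (1 + j%:R ^+ 2), (2 * j%:R) / (1 + j%:R ^+ 2)).

Definition circle_hull (R : realType) n (B : {set 'I_n}) : set (R * R) :=
  [set z | exists c : 'I_n -> R,
    [/\ forall j, 0 <= c j, \sum_(j in B) c j = 1,
        z.1 = \sum_(j in B) c j * (circle_pt R j).1 &
        z.2 = \sum_(j in B) c j * (circle_pt R j).2]]%classic.

Arguments circle_hull R [n] B _.

Definition riordan_partition (R : realType) n (P : {set {set 'I_n}}) : Prop :=
  [/\ finset.partition P [set: 'I_n],
      forall B, B \in P -> (1 < #|B|)%N &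
      forall A B, A \in P -> B \in P -> A != B ->
        (circle_hull R A `&` circle_hull R B)%classic = classical_sets.set0].

(** * Riordan trees

    Graphs are sets of unordered edges on the following vertices: [inl j] is
    the univalent vertex labeled j, [inr j] is the trivalent vertex carrying the
    leg labeled j. *)
Definition vertex n := ('I_n + 'I_n)%type.
Definition graph n := {set {set vertex n}}.

Definition middle n (B : {set 'I_n}) : {set 'I_n} :=
  [set j in B | [exists i in B, (i < j)%N] && [exists i in B, (j < i)%N]].

Definition spine n (B : {set 'I_n}) : seq (vertex n) :=
  [seq (if j \in middle B then inr j else inl j) | j <- enum B].

Definition linear_tree n (B : {set 'I_n}) : graph n :=
  [set:: [seq [set p.1; p.2] | p <- zip (spine B) (behead (spine B))]]
    :|: [set [set (inl j : vertex n); inr j] | j in middle B].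

Definition riordan_tree (R : realType) n (T : graph n) : Prop :=
  exists2 P : {set {set 'I_n}},
    riordan_partition R P & T = \bigcup_(B in P) linear_tree B.

Definition internal_edges n (T : graph n) : graph n :=
  [set e in T | e \subset [set (inr j : vertex n) | j in 'I_n]].

Definition adj n (T : graph n) : rel (vertex n) :=
  fun x y => [set x; y] \in T.

Definition label_partition n (T : graph n) : {set {set 'I_n}} :=
  equivalence_partition
    (fun i j => connect (adj T) (inl i) (inl j)) [set: 'I_n].

(** * The elements f(T) *)

Definition f (k : fieldType) (q : k) n (T : graph n) : tens k 2 n :=
  \sum_(E in powerset (internal_edges T))
    (qint q 2) ^- #|E| *: f0 q (label_partition (T :\: E)).

Definition BJW (R : realType) n : set (tens (Cq R) 2 n) :=
  [set f (qvar R) T | T in [set T | riordan_tree R T]]%classic.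

Arguments BJW : clear implicits.

(** [S] is a linear subspace and the set [B] is a finite basis of it; the
    elements of a free sequence are pairwise distinct. *)
Definition is_basis (k : fieldType) (V : vectType k) (B S : set V) : Prop :=
  exists2 X : seq V,
    free X & ([set` X] = B /\ [set x | x \in <<X>>%VS] = S)%classic.

(* Main.v *)
Require Import Defs.
From mathcomp Require Import classical_sets boolp reals complex.
From mathcomp Require Import all_boot all_order all_algebra.
From mathcomp Require Import ring zify.

(** The elements f(T) form a triangular family with respect to the coefficients
    of an invariant vector at the words of Riordan partitions, and an invariant
    vector is determined by these coefficients.

    A word is an index of a basis tensor of $V_2^{\otimes n}$, with letters [lo],
    [mid], [hi] for $v_{-2}$, $v_0$, $v_2$; its height at a gap between two positions
    is half the weight of the part to the right of the gap. The word of a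
    noncrossing partition without singletons has [lo] at the minimum of each
    block, [hi] at the maximum and [mid] elsewhere, and its height at a gap is the
    number of blocks with elements on both sides of it. Such words are exactly
    those of total height zero whose height never becomes negative and which
    have no [mid] at height zero, and the partition is recovered from its word by
    matching brackets ([word_partition_of], [partition_of_word]). Disjointness of
    the convex hulls on the circle is equivalent to being noncrossing
    ([riordan_noncrossing], [noncrossing_riordan]).

    Determination by coefficients ([highest_eq0]): if a highest weight vector
    $v_2\otimes a+v_0\otimes b+v_{-2}\otimes c$ vanishes at all such words, then $c$
    is a highest weight vector and $c=0$ by induction; next $b$ is one, and it is
    zero by induction or, in weight zero, because it lies in the image of $E$; then
    $a=0$ by induction. This uses that $E$ is injective on vectors of negative
    weight and $E^2$ on those of weight $-2$, which follow from the commutation of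
    $E$ with the powers of $F$ ([FE_neg_eq0]) and from $q$ not being a root of
    unity.

    Invariance ([actE_uP], [actE_pi2]): each arc carries the invariant tensor of
    $V_1\otimes V_1$, the signs enclosed by an arc cancel, and $\pi_2$ commutes with
    the action.

    Triangularity: a sign vector contributing to a coefficient of $f^0(P)$ has
    opposite signs at the ends of each arc, so that only arcs crossing a gap
    contribute to the height there. Hence the heights of the words occurring in
    $f^0(P)$ are bounded by those of the word of $P$, at which the coefficient is a
    single nonzero product ([f0_le], [f0_word]). Removing a set of internal edges
    cuts blocks into intervals, which lowers the height at every removed edge and
    raises it nowhere ([open_blocks_cut], [open_blocks_cut_lt]). Thus f(T) has the
    same leading word and the same leading coefficient as $f^0(T)$
    ([f_tree_le], [f_tree_word]). *)

Set Implicit Arguments.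
Unset Strict Implicit.
Unset Printing Implicit Defensive.

Import Order.TTheory GRing.Theory Num.Theory.

Local Open Scope ring_scope.

(** * The action of $U_q$ on tensor powers *)

Section TensorModule.
Variables (k : fieldType) (q : k).
Hypothesis q0 : q != 0.

Definition slice m n (x : tens k m n.+1) (a : 'I_m.+1) : tens k m n :=
  [ffun s : n.-tuple 'I_m.+1 => x [tuple of a :: s]].

Lemma sliceE m n (x : tens k m n.+1) a (s : n.-tuple 'I_m.+1) :
  slice x a s = x [tuple of a :: s].
Proof. by rewrite ffunE. Qed.

Lemma slice_ext m n (x y : tens k m n.+1) :
  (forall a, slice x a = slice y a) -> x = y.
Proof.
move=> exy; apply/ffunP => t; case/tupleP: t => a s.
by have /ffunP/(_ s) := exy a; rewrite !sliceE.
Qed.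

Lemma sliceD m n (x y : tens k m n.+1) a :
  slice (x + y) a = slice x a + slice y a.
Proof. by apply/ffunP => s; rewrite !ffunE. Qed.

Lemma sliceZ m n c (x : tens k m n.+1) a : slice (c *: x) a = c *: slice x a.
Proof. by apply/ffunP => s; rewrite !ffunE. Qed.

Lemma sliceB m n (x y : tens k m n.+1) a :
  slice (x - y) a = slice x a - slice y a.
Proof. by rewrite -scaleN1r sliceD sliceZ scaleN1r. Qed.

Lemma slice_tens_op m n (A : 'M[k]_m.+1) (B : tens k m n -> tens k m n) x c :
  slice (tens_op A B x) c = \sum_a A c a *: B (slice x a).
Proof.
apply/ffunP => s; rewrite !ffunE sum_ffunE; apply: eq_bigr => a _.
rewrite !ffunE theadE (_ : [tuple of behead [tuple of c :: s]] = s) //.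
by apply: val_inj.
Qed.

Lemma actE_lin m n c (x y : tens k m n) :
  actE q (c *: x + y) = c *: actE q x + actE q y.
Proof.
elim: n c x y => [|n IHn] c x y /=; first by rewrite scaler0 addr0.
apply: slice_ext => a; rewrite !sliceD sliceZ !sliceD !slice_tens_op.
rewrite scalerDr !scaler_sumr addrACA -!big_split /=.
apply: eq_bigr => b _.
by rewrite sliceD sliceZ IHn !scalerDr !scalerA ![c * _]mulrC.
Qed.

Lemma actE0 m n : actE q (0 : tens k m n) = 0.
Proof. by have := actE_lin (-1) (0 : tens k m n) 0; rewrite !scaleN1r !addNr. Qed.

Lemma actED m n (x y : tens k m n) : actE q (x + y) = actE q x + actE q y.
Proof. by have := actE_lin 1 x y; rewrite !scale1r. Qed.

Lemma actEZ m n c (x : tens k m n) : actE q (c *: x) = c *: actE q x.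
Proof. by have := actE_lin c x 0; rewrite actE0 !addr0. Qed.

(** The weight of a basis tensor; the index $j$ stands for the weight $2j-m$. *)
Definition wt m (s : seq 'I_m.+1) : int := \sum_(j <- s) ((j.*2)%:Z - m%:Z).

Lemma wt_cons m (c : 'I_m.+1) s : wt (c :: s) = ((c.*2)%:Z - m%:Z) + wt s.
Proof. by rewrite /wt big_cons. Qed.

Lemma actK_E m n (x : tens k m n) t : actK q x t = q ^ (wt t) * x t.
Proof.
elim: n x t => [|n IHn] x t /=; first by rewrite tuple0 /wt big_nil mul1r.
case/tupleP: t => c s; rewrite -sliceE slice_tens_op sum_ffunE.
rewrite (bigD1 c) //= big1 ?addr0.
  by rewrite ffunE IHn sliceE mxE eqxx wt_cons [in RHS]expfzDr // -mulrA.
by move=> b bc; rewrite mxE eq_sym (negPf bc) scale0r ffunE.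
Qed.

Lemma actKinv_E m n (x : tens k m n) t : actKinv q x t = q ^ (- wt t) * x t.
Proof.
elim: n x t => [|n IHn] x t /=; first by rewrite tuple0 /wt big_nil mul1r.
case/tupleP: t => c s; rewrite -sliceE slice_tens_op sum_ffunE.
rewrite (bigD1 c) //= big1 ?addr0.
  by rewrite ffunE IHn sliceE mxE eqxx wt_cons [in RHS]opprD [in RHS]expfzDr // -mulrA.
by move=> b bc; rewrite mxE eq_sym (negPf bc) scale0r ffunE.
Qed.

Lemma actKD m n (x y : tens k m n) : actK q (x + y) = actK q x + actK q y.
Proof. by apply/ffunP=> t; rewrite !ffunE !actK_E !ffunE mulrDr. Qed.

Lemma actKZ m n c (x : tens k m n) : actK q (c *: x) = c *: actK q x.
Proof. by apply/ffunP=> t; rewrite !ffunE !actK_E !ffunE [LHS]mulrCA. Qed.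

Lemma actF_lin m n c (x y : tens k m n) :
  actF q (c *: x + y) = c *: actF q x + actF q y.
Proof.
elim: n c x y => [|n IHn] c x y /=; first by rewrite scaler0 addr0.
apply: slice_ext => a; rewrite !sliceD sliceZ !sliceD !slice_tens_op.
rewrite scalerDr !scaler_sumr addrACA -!big_split /=.
apply: eq_bigr => b _.
by rewrite sliceD sliceZ IHn actKD actKZ !scalerDr !scalerA ![c * _]mulrC.
Qed.

Lemma actF0 m n : actF q (0 : tens k m n) = 0.
Proof. by have := actF_lin (-1) (0 : tens k m n) 0; rewrite !scaleN1r !addNr. Qed.

Lemma actFD m n (x y : tens k m n) : actF q (x + y) = actF q x + actF q y.
Proof. by have := actF_lin 1 x y; rewrite !scale1r. Qed.

Lemma actFZ m n c (x : tens k m n) : actF q (c *: x) = c *: actF q x.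
Proof. by have := actF_lin c x 0; rewrite actF0 !addr0. Qed.

End TensorModule.

(** * Highest weight vectors in the tensor powers of $V_2$ *)

Section AdjointModule.
Variables (k : fieldType) (q : k).
Hypothesis q0 : q != 0.
Hypothesis q_nonroot : forall m, (0 < m)%N -> q ^+ m != 1.

Local Notation "[ 'q' m ]" := (qint q m) (format "[ 'q'  m ]").
Local Notation E := (actE q).
Local Notation F := (actF q).
Local Notation K := (actK q).
Local Notation Kinv := (actKinv q).

Definition lo : 'I_3 := Ordinal (isT : 0 < 3)%N.
Definition mid : 'I_3 := Ordinal (isT : 1 < 3)%N.
Definition hi : 'I_3 := Ordinal (isT : 2 < 3)%N.

Lemma ord3P (P : 'I_3 -> Prop) : P lo -> P mid -> P hi -> forall c, P c.
Proof.
move=> P0 P1 P2 [[|[|[|c]]] //= Hc].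
- by rewrite (_ : Ordinal Hc = lo) //; apply: val_inj.
- by rewrite (_ : Ordinal Hc = mid) //; apply: val_inj.
- by rewrite (_ : Ordinal Hc = hi) //; apply: val_inj.
Qed.

Lemma big_ord3 (V : nmodType) (G : 'I_3 -> V) :
  \sum_c G c = G lo + G mid + G hi.
Proof.
rewrite !big_ord_recl big_ord0 addr0 addrA.
by congr (G _ + G _ + G _); apply: val_inj.
Qed.

Lemma qq_neq0 : q - q^-1 != 0.
Proof.
apply/eqP => e; have /eqP := q_nonroot (isT : 0 < 2)%N; apply.
by rewrite expr2 -{1}(subrK q^-1 q) e add0r mulVf.
Qed.

Lemma qint1 : [q 1] = 1.
Proof. by rewrite /qint !expr1 divff ?qq_neq0. Qed.

Lemma qint_neq0 m : (0 < m)%N -> [q m] != 0.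
Proof.
move=> m0; rewrite /qint mulf_neq0 ?invr_neq0 ?qq_neq0 //.
apply/eqP => e; have /eqP := q_nonroot (isT : 0 < 2)%N.
have qm0 : q ^+ m != 0 by rewrite expf_neq0.
have /eqP := @q_nonroot (m + m) ltac:(by rewrite addn_gt0 m0); case.
by rewrite exprD -{1}(subrK (q ^- m) (q ^+ m)) e add0r mulVf.
Qed.

Lemma sliceE_lo n (x : tens k 2 n.+1) :
  slice (E x) lo = q ^+ 2 *: E (slice x lo).
Proof.
rewrite /= sliceD !slice_tens_op !big_ord3 !mxE /= !scale0r !add0r.
by rewrite !addr0.
Qed.

Lemma sliceE_mid n (x : tens k 2 n.+1) :
  slice (E x) mid = slice x lo + E (slice x mid).
Proof.
rewrite /= sliceD !slice_tens_op !big_ord3 !mxE /= !scale0r !add0r.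
by rewrite !addr0 qint1 -[_ ^ (- _)]/(1 : k) !scale1r.
Qed.

Lemma sliceE_hi n (x : tens k 2 n.+1) :
  slice (E x) hi = [q 2] *: slice x mid + q ^- 2 *: E (slice x hi).
Proof.
by rewrite /= sliceD !slice_tens_op !big_ord3 !mxE /= !scale0r !add0r !addr0.
Qed.

Lemma sliceF_lo n (x : tens k 2 n.+1) :
  slice (F x) lo = [q 2] *: K (slice x mid) + F (slice x lo).
Proof.
rewrite /= sliceD !slice_tens_op !big_ord3 !mxE /= !scale0r !add0r.
by rewrite !addr0 scale1r.
Qed.

Lemma sliceF_mid n (x : tens k 2 n.+1) :
  slice (F x) mid = K (slice x hi) + F (slice x mid).
Proof.
rewrite /= sliceD !slice_tens_op !big_ord3 !mxE /= !scale0r !add0r.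
by rewrite !addr0 qint1 !scale1r.
Qed.

Lemma sliceF_hi n (x : tens k 2 n.+1) : slice (F x) hi = F (slice x hi).
Proof.
rewrite /= sliceD !slice_tens_op !big_ord3 !mxE /= !scale0r !add0r.
by rewrite !scale1r.
Qed.

Lemma sliceK n (x : tens k 2 n.+1) c :
  slice (K x) c = q ^ ((c.*2)%:Z - 2) *: K (slice x c).
Proof.
rewrite /= slice_tens_op (bigD1 c) //= big1 ?addr0 ?mxE ?eqxx //.
by move=> b bc; rewrite mxE eq_sym (negPf bc) scale0r.
Qed.

Lemma sliceKinv n (x : tens k 2 n.+1) c :
  slice (Kinv x) c = q ^ (- ((c.*2)%:Z - 2)) *: Kinv (slice x c).
Proof.
rewrite /= slice_tens_op (bigD1 c) //= big1 ?addr0 ?mxE ?eqxx //.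
by move=> b bc; rewrite mxE eq_sym (negPf bc) scale0r.
Qed.

Lemma KE_comm n (x : tens k 2 n) : K (E x) = q ^+ 2 *: E (K x).
Proof.
elim: n x => [|n IHn] x; first by rewrite /= scaler0.
have q20 : q ^+ 2 != 0 by rewrite expf_neq0.
apply: slice_ext; apply: ord3P; rewrite sliceK sliceZ.
- rewrite !sliceE_lo actKZ // IHn sliceK actEZ //= !scalerA.
  by congr (_ *: _); rewrite -[_ ^ (0 - 2)]/(q ^- 2); field.
- rewrite !sliceE_mid actKD // IHn !sliceK actEZ //= !scalerDr !scalerA.
  rewrite -[_ ^ (0 - 2)]/(q ^- 2) -[_ ^ (2 - 2)]/(1 : k) mul1r mulr1.
  by congr (_ *: _ + _); field.
- rewrite !sliceE_hi actKD // !actKZ // IHn !sliceK actEZ //= !scalerDr !scalerA.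
  rewrite -[_ ^ (4 - 2)]/(q ^+ 2) -[_ ^ (2 - 2)]/(1 : k) mulr1.
  by congr (_ *: _ + _ *: _); field.
Qed.

Lemma KF_comm n (x : tens k 2 n) : K (F x) = q ^- 2 *: F (K x).
Proof.
elim: n x => [|n IHn] x; first by rewrite /= scaler0.
have q20 : q ^+ 2 != 0 by rewrite expf_neq0.
apply: slice_ext; apply: ord3P; rewrite sliceK sliceZ.
- rewrite !sliceF_lo actKD // actKZ // IHn !sliceK actFZ //= !scalerDr !scalerA.
  rewrite -[_ ^ (0 - 2)]/(q ^- 2) -[_ ^ (2 - 2)]/(1 : k).
  by rewrite actKZ // scale1r.
- rewrite !sliceF_mid actKD // IHn !sliceK actFZ //= !scalerDr !scalerA.
  rewrite -[_ ^ (4 - 2)]/(q ^+ 2) -[_ ^ (2 - 2)]/(1 : k) mul1r mulr1 actKZ //.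
  by rewrite scalerA mulVf // scale1r.
- rewrite !sliceF_hi IHn sliceK actFZ //= !scalerA; congr (_ *: _).
  by rewrite mulrC.
Qed.

(** The defining relation $[E,F]=(K-K^{-1})/(q-q^{-1})$ passes from a factor to
    the tensor product because the two mixed terms cancel. *)
Lemma EF_comm n (x : tens k 2 n) :
  E (F x) - F (E x) = (q - q^-1)^-1 *: (K x - Kinv x).
Proof.
elim: n x => [|n IHn] x.
  by rewrite /= !subrr scaler0.
have qq : q * q - 1 != 0 by rewrite subr_eq0 -expr2 q_nonroot.
have IH (y : tens k 2 n) : E (F y) = F (E y) + (q - q^-1)^-1 *: (K y - Kinv y).
  by have /eqP := IHn y; rewrite subr_eq addrC => /eqP.
apply: slice_ext; apply: ord3P; rewrite sliceZ !sliceB.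
- rewrite sliceE_lo !sliceF_lo actED // actEZ // IH sliceE_lo sliceE_mid.
  rewrite !actKD // actFZ // sliceK sliceKinv KE_comm.
  apply/ffunP => t; rewrite !ffunE /= -[_ ^ (0 - 2)]/(q ^- 2).
  rewrite -[_ ^ (- (0 - 2))]/(q ^+ 2) !actK_E // !actKinv_E // /qint.
  by rewrite /GRing.scale /=; field; rewrite q0.
- rewrite sliceE_mid sliceF_lo !sliceF_mid actED // IH sliceE_hi sliceE_mid.
  rewrite !actKD // !actKZ // actFD // sliceK sliceKinv KE_comm.
  apply/ffunP => t; rewrite !ffunE /= -[_ ^ (2 - 2)]/(1 : k).
  rewrite /GRing.scale /=.
  by field; rewrite q0.
- rewrite sliceE_hi !sliceF_hi sliceF_mid IH sliceE_hi.
  rewrite actFD // !actFZ // sliceK sliceKinv !scalerDr.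
  apply/ffunP => t; rewrite !ffunE /= -[_ ^ (4 - 2)]/(q ^+ 2).
  rewrite -[_ ^ (- (4 - 2))]/(q ^- 2) !actK_E // !actKinv_E // /qint.
  by rewrite /GRing.scale /=; field; rewrite q0.
Qed.

(** Half the weight of a basis tensor of $V_2^{\otimes n}$. *)
Definition ht (s : seq 'I_3) : int := \sum_(j <- s) (j%:Z - 1).

Lemma ht_cons (c : 'I_3) s : ht (c :: s) = (c%:Z - 1) + ht s.
Proof. by rewrite /ht big_cons. Qed.

Lemma wt_ht (s : seq 'I_3) : wt s = 2 * ht s.
Proof.
elim: s => [|c s IHs]; first by rewrite /wt /ht !big_nil mulr0.
by rewrite wt_cons ht_cons IHs; lia.
Qed.

Lemma ht_ge (s : seq 'I_3) : - (size s)%:Z <= ht s.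
Proof.
elim: s => [|c s IHs]; first by rewrite /ht big_nil.
by rewrite ht_cons /=; lia.
Qed.

Lemma expq_eq1 (z : int) : q ^ z = 1 -> z = 0.
Proof.
case: z => [[|m]|m] //.
  by rewrite -exprnP => /eqP; rewrite (negPf (q_nonroot _)).
rewrite NegzE -exprnN => /(congr1 (fun y => y^-1)); rewrite invrK invr1 => /eqP.
by rewrite (negPf (q_nonroot _)).
Qed.

(** Vectors of weight $2h$. *)
Definition homog n (h : int) (x : tens k 2 n) := K x = q ^ (2 * h) *: x.

Lemma homogP n h (x : tens k 2 n) :
  homog h x <-> forall t, x t != 0 -> ht t = h.
Proof.
split=> [hx t xt|hx].
  have /ffunP/(_ t) := hx; rewrite actK_E // ffunE wt_ht => /(mulIf xt) e.
  suff : 2 * ht t - 2 * h = 0 by lia.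
  by apply: expq_eq1; rewrite expfzDr // e -expfzDr // subrr.
apply/ffunP=> t; rewrite actK_E // ffunE wt_ht.
by have [->|/hx ->//] := eqVneq (x t) 0; rewrite /GRing.scale /= !mulr0.
Qed.

Lemma homog_E n h (x : tens k 2 n) : homog h x -> homog (h + 1) (E x).
Proof.
rewrite /homog => hx; rewrite KE_comm hx actEZ // scalerA; congr (_ *: _).
by rewrite mulrDr mulr1 expfzDr // mulrC.
Qed.

Lemma homog_F n h (x : tens k 2 n) : homog h x -> homog (h - 1) (F x).
Proof.
rewrite /homog => hx; rewrite KF_comm hx actFZ // scalerA; congr (_ *: _).
by rewrite mulrBr mulr1 expfzDr // mulrC.
Qed.

Lemma homog_iterF n h (x : tens k 2 n) r :
  homog h x -> homog (h - r%:Z) (iter r (@actF _ q 2 n) x).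
Proof.
move=> hx; elim: r => [|r IHr]; first by rewrite subr0.
by have := homog_F IHr; congr (homog _ _); lia.
Qed.

Lemma EF_homog n h (x : tens k 2 n) : homog h x ->
  E (F x) = F (E x) + ((q ^ (2 * h) - q ^ (- (2 * h))) / (q - q^-1)) *: x.
Proof.
move=> hx; have /eqP := EF_comm x; rewrite subr_eq addrC => /eqP ->.
congr (_ + _); rewrite hx; apply/ffunP => t; rewrite !ffunE actKinv_E // wt_ht.
have [->|xt] := eqVneq (x t) 0; first by rewrite /GRing.scale /= !mulr0 subrr !mulr0.
by have /homogP/(_ t xt) -> := hx; rewrite /GRing.scale /= -mulrBl mulrCA mulrA.
Qed.

(** On vectors of weight $2h$ the commutator $EF-FE$ is the scalar $[2h]$. If
    $FEa=0$, then $a_r=F^ra$ satisfies $Ea_{r+1}=-[r+1][r+2g]a_r$, where the scalar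
    is nonzero. As the weights are bounded below, $a_r=0$ for large $r$, and this
    propagates down to $a_0=a$. *)
Lemma FE_neg_eq0 n (g : nat) (a : tens k 2 n) :
  (0 < g)%N -> homog (- g%:Z) a -> F (E a) = 0 -> a = 0.
Proof.
move=> g0 ha FEa; pose b r := iter r (@actF _ q 2 n) a.
have qq : q * q - 1 != 0 by rewrite subr_eq0 -expr2 q_nonroot.
have Eb r : E (b r.+1) = - ([q r.+1] * [q (r + g.*2)]) *: b r.
  elim: r => [|r IHr].
    rewrite /b /= (EF_homog ha) FEa add0r qint1 mul1r; congr (_ *: _).
    rewrite add0n /qint -[in RHS]mulNr [in RHS]opprB; congr ((_ - _) / _).
      by rewrite exprnN; congr (_ ^ _); lia.
    by rewrite exprnP; congr (_ ^ _); lia.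
  rewrite -[b r.+2]/(F (b r.+1)) (EF_homog (homog_iterF _ ha)) -/(b _) IHr.
  rewrite actFZ // -[F (b r)]/(b r.+1) -scalerDl; congr (_ *: _).
  set z := 2 * _.
  have ->: q ^ z = q ^- (r + r + 2 + g.*2).
    by rewrite exprnN; congr (_ ^ _); rewrite /z; lia.
  have ->: q ^ (- z) = q ^+ (r + r + 2 + g.*2).
    by rewrite exprnP; congr (_ ^ _); rewrite /z; lia.
  rewrite /qint !addSn !exprS !exprD.
  by field; rewrite q0 qq !expf_neq0.
have bn : b n.+1 = 0.
  apply/ffunP => t; rewrite [RHS]ffunE; apply/eqP/negPn/negP => /= bt.
  have /homogP/(_ t bt) := homog_iterF n.+1 ha.
  by have := ht_ge t; rewrite size_tuple; lia.
have step r : b r.+1 = 0 -> b r = 0.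
  move=> br; have := Eb r; rewrite br actE0 // => /esym/eqP.
  rewrite scaler_eq0 oppr_eq0 mulf_eq0 !(negPf (qint_neq0 _)) //=.
    by move/eqP.
  by rewrite addn_gt0 double_gt0 g0 orbT.
rewrite -[a]/(b 0%N); elim: n.+1 bn => // r IHr /step; exact: IHr.
Qed.

Lemma E_neg_inj n (h : int) (a : tens k 2 n) :
  h < 0 -> homog h a -> E a = 0 -> a = 0.
Proof.
move=> h0 ha Ea; apply: (@FE_neg_eq0 n `|h|%N a); first by lia.
  by rewrite (_ : - _ = h) //; lia.
by rewrite Ea actF0.
Qed.

(** The vector $Fa$ has negative weight, and $EFa=FEa=0$ in weight zero. *)
Lemma F_highest0 n (a : tens k 2 n) : homog 0 a -> E a = 0 -> F a = 0.
Proof.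
move=> ha Ea; apply: (@E_neg_inj n (-1)) => //.
  by rewrite -[-1]add0r; apply: homog_F.
by rewrite (EF_homog ha) Ea actF0 // mulr0 expr0z subrr mul0r scale0r addr0.
Qed.

(** The vector $Ea$ has weight zero and is killed by $E$, hence also by $F$. *)
Lemma EE_neg1_inj n (a : tens k 2 n) : homog (-1) a -> E (E a) = 0 -> a = 0.
Proof.
move=> ha EEa; apply: (@FE_neg_eq0 n 1) => //.
by apply: F_highest0 => //; have := homog_E ha; rewrite addNr.
Qed.

Lemma InvP n (x : tens k 2 n) : Inv q n x <-> E x = 0 /\ homog 0 x.
Proof.
rewrite /Inv /= /homog mulr0 expr0z scale1r; split=> [[]//|[Ex Kx]].
by split=> //; apply: F_highest0 => //; rewrite /homog mulr0 expr0z scale1r.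
Qed.

(** Read from right to left, these are the words in which the height never
    becomes negative and a letter [mid] never occurs at height zero. The second
    condition reflects that a nonzero vector of weight zero killed by $E$ is
    not in the image of $E$. *)
Fixpoint good (s : seq 'I_3) : bool :=
  if s is c :: s' then good s' && ((c == hi) || (1 <= ht s')) else true.

Lemma homog_slice n h (x : tens k 2 n.+1) (c : 'I_3) :
  homog h x -> homog (h + 1 - c%:Z) (slice x c).
Proof.
move/homogP=> hx; apply/homogP=> t; rewrite sliceE => /hx.
by have := ht_cons c t => /= ->; lia.
Qed.

(** If $x=v_2\otimes a+v_0\otimes b+v_{-2}\otimes c$ is killed by $E$, then $c$
    is a highest weight vector; once $c=0$ so is $b$, which lies in the image of
    $E$ and therefore vanishes in weight zero; and once $b=0$ so is $a$. *)
Lemma highest_eq0 n h (x : tens k 2 n) : homog h x -> E x = 0 ->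
  (forall t : n.-tuple 'I_3, good t -> x t = 0) -> x = 0.
Proof.
elim: n h x => [|n IHn] h x hx Ex x0.
  by apply/ffunP => t; rewrite x0 ?ffunE // tuple0.
have [h0|h0] := ltP h 0; first exact: E_neg_inj hx Ex.
have sE c : slice (E x) c = 0 by apply/ffunP => s; rewrite Ex !ffunE.
have slice0 c : E (slice x c) = 0 -> (c == hi) || (1 <= h + 1 - c%:Z) ->
    slice x c = 0.
  move=> Ec hc; apply: (IHn _ _ (homog_slice c hx)) => // s gs.
  rewrite sliceE; apply/eqP/negPn/negP => xs; case/negP: (xs); apply/eqP.
  apply: x0; rewrite /= gs /=.
  have := ht_cons c s; move/homogP/(_ _ xs): hx => /= -> hs.
  by move: hc; case: eqP => //= _; lia.
have xlo : slice x lo = 0.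
  apply: slice0; last by rewrite /=; lia.
  have /eqP := sE lo; rewrite sliceE_lo scaler_eq0 expf_eq0 /= (negPf q0).
  by move/eqP.
have Emid : E (slice x mid) = 0.
  by have := sE mid; rewrite sliceE_mid xlo add0r.
have ehi := sE hi; rewrite sliceE_hi in ehi.
have xmid : slice x mid = 0.
  have [h1|h1] := leP 1 h; first by apply: slice0 => //=; lia.
  have q2 := qint_neq0 (isT : 0 < 2)%N.
  have e0 : E (E (slice x hi)) = 0.
    have := congr1 (actE q (n := n)) ehi.
    rewrite actED // !actEZ // Emid scaler0 add0r actE0 // => /eqP.
    by rewrite scaler_eq0 invr_eq0 expf_eq0 /= (negPf q0) => /eqP.
  have hhi : slice x hi = 0.
    apply: EE_neg1_inj e0; have := homog_slice hi hx; congr (homog _ _) => /=.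
    by lia.
  move: ehi; rewrite hhi actE0 // scaler0 addr0 => /eqP.
  by rewrite scaler_eq0 (negPf q2) => /eqP.
have xhi : slice x hi = 0.
  apply: slice0 => //; move: ehi; rewrite xmid scaler0 add0r => /eqP.
  by rewrite scaler_eq0 invr_eq0 expf_eq0 /= (negPf q0) => /eqP.
apply: slice_ext; apply: ord3P; rewrite ?xlo ?xmid ?xhi;
  by apply/ffunP => s; rewrite !ffunE.
Qed.

End AdjointModule.

(** * Noncrossing partitions and their arcs *)

Section BlockSuccessor.
Variable n : nat.
Implicit Types (P : {set {set 'I_n}}) (i j a b c d : 'I_n).

Lemma sorted_enum (A : {set 'I_n}) :
  sorted (fun i j : 'I_n => (i < j)%N) (enum A).
Proof.
have -> : enum A = filter [in A] (enum 'I_n).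
  by rewrite {1}/enum_mem -enumT.
apply: sorted_filter => [? ? ?|]; first exact: ltn_trans.
by have := iota_ltn_sorted 0 n; rewrite -val_enum_ord sorted_map.
Qed.

Lemma next_sorted (l : seq 'I_n) j :
  sorted (fun i j : 'I_n => (i < j)%N) l -> j \in l ->
  ((j < next l j)%N /\
     forall c, c \in l -> (c <= j)%N || (next l j <= c)%N) \/
  ((next l j <= j)%N /\
     forall c, c \in l -> (next l j <= c <= j)%N).
Proof.
move=> sl jl; rewrite next_nth jl; case: l sl jl => // y p sl jl.
set l := y :: p in sl jl *.
have ltT : transitive (fun i j : 'I_n => (i < j)%N).
  by move=> ? ? ?; exact: ltn_trans.
have ltl u v : (u < size l)%N -> (v < size l)%N -> (u < v)%N ->
    (nth y l u < nth y l v)%N.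
  by move=> ul vl; apply: (sorted_ltn_nth ltT y sl).
have lel u v : (u < size l)%N -> (v < size l)%N -> (u <= v)%N ->
    (nth y l u <= nth y l v)%N.
  move=> ul vl; rewrite leq_eqVlt => /predU1P[->//|uv].
  by apply/ltnW/ltl.
have jlt : (index j l < size l)%N by rewrite index_mem.
have [ip|ip] := ltnP (index j l) (size p); [left|right].
  have nE : nth y p (index j l) = nth y l (index j l).+1 by [].
  rewrite nE; split=> [|c cl]; first by rewrite -{1}(nth_index y jl) ltl.
  have clt : (index c l < size l)%N by rewrite index_mem.
  rewrite -(nth_index y cl) -{1}(nth_index y jl).
  have [ci|ic] := leqP (index c l) (index j l); first by rewrite lel.
  by rewrite [X in _ || X]lel ?orbT.
rewrite nth_default // (_ : y = nth y l 0) //.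
have last : index j l = (size l).-1.
  by apply/eqP; rewrite eqn_leq ip -ltnS jlt.
split=> [|c cl]; first by rewrite -[in X in (_ <= X)%N](nth_index y jl) lel.
have clt : (index c l < size l)%N by rewrite index_mem.
rewrite -(nth_index y cl) -[in X in (_ && (_ <= X))%N](nth_index y jl) !lel // last.
by rewrite -ltnS prednK.
Qed.

(** The cyclic successor of [j] in its block. The arcs of a partition form the
    graph of this permutation, which makes sums and products over arcs into sums
    and products over ['I_n]. *)
Definition nxt P j : 'I_n := next (enum (pblock P j)) j.

Definition noncrossing P := forall a b c d,
  (a < b)%N -> (b < c)%N -> (c < d)%N ->
  c \in pblock P a -> d \in pblock P b -> b \in pblock P a.

Variable P : {set {set 'I_n}}.
Hypothesis hP : finset.partition P [set: 'I_n].

Let tP : finset.trivIset P. Proof. by case/and3P: hP. Qed.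

Lemma mem_pb j : j \in pblock P j.
Proof. by rewrite mem_pblock (cover_partition hP) inE. Qed.

Lemma pb_eq i j : (j \in pblock P i) = (pblock P i == pblock P j).
Proof.
by apply/idP/eqP => [/(same_pblock tP)->|->]; last exact: mem_pb.
Qed.

Lemma pb_sym i j : (j \in pblock P i) = (i \in pblock P j).
Proof. by rewrite !pb_eq eq_sym. Qed.

Lemma nxt_in j : nxt P j \in pblock P j.
Proof. by have := mem_pb j; rewrite -mem_enum -mem_next mem_enum. Qed.

Lemma pb_nxt j : pblock P (nxt P j) = pblock P j.
Proof. by apply/eqP; rewrite eq_sym -pb_eq nxt_in. Qed.

Lemma nxtP j :
  ((j < nxt P j)%N /\
     forall c, c \in pblock P j -> (c <= j)%N || (nxt P j <= c)%N) \/
  ((nxt P j <= j)%N /\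
     forall c, c \in pblock P j -> (nxt P j <= c <= j)%N).
Proof.
have := @next_sorted (enum (pblock P j)) j (sorted_enum _).
rewrite mem_enum => /(_ (mem_pb j)) [[h1 h2]|[h1 h2]]; [left|right];
  by split=> // c cj; apply: h2; rewrite mem_enum.
Qed.

Lemma nxt_inj : injective (nxt P).
Proof.
move=> i j e; have pij : pblock P i = pblock P j by rewrite -pb_nxt e pb_nxt.
move: e; rewrite /nxt pij.
exact: (can_inj (prev_next (enum_uniq (pblock P j)))).
Qed.

Lemma nxt_min j : (nxt P j <= j)%N ->
  forall c, c \in pblock P j -> (nxt P j <= c <= j)%N.
Proof. by case: (nxtP j) => [[h _]|[]//] h'; move: h; rewrite ltnNge h'. Qed.

Lemma nxt_max j : (j < nxt P j)%N ->
  forall c, c \in pblock P j -> (c <= j)%N || (nxt P j <= c)%N.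
Proof. by case: (nxtP j) => [[]//|[h _]] h'; move: h; rewrite leqNgt h'. Qed.

Lemma nxt_gtE j : (j < nxt P j)%N = [exists i in pblock P j, (j < i)%N].
Proof.
apply/idP/exists_inP => [jn|[i ij ji]]; first by exists (nxt P j); rewrite ?nxt_in.
by rewrite ltnNge; apply/negP => /nxt_min/(_ i ij)/andP[_]; rewrite leqNgt ji.
Qed.

Hypothesis ncP : noncrossing P.

(** A block that meets the gap between two consecutive elements of another block
    cannot leave it without crossing the other block. *)
Lemma gap_closed j x y : y \in pblock P x -> x \notin pblock P j ->
  (j < nxt P j)%N -> (j < x < nxt P j)%N -> (j < y < nxt P j)%N.
Proof.
move=> xy xj jn /andP[jx xn].
have yj : y \notin pblock P j by move: xy xj; rewrite !pb_eq => /eqP->.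
have nj := nxt_in j.
have [yltj|yj'] := ltnP y j.
  have := ncP yltj jx xn; rewrite pb_sym xy nj => /(_ isT isT) h.
  by case/negP: yj; rewrite pb_sym.
have [ynlt|ny] := ltnP (nxt P j) y.
  have := ncP jx xn ynlt; rewrite nj xy => /(_ isT isT) h.
  by case/negP: xj.
have ne1 : y != j by apply: contraNneq yj => ->; apply: mem_pb.
have ne2 : y != nxt P j by apply: contraNneq yj => ->.
by move: ne1 ne2; rewrite -!(inj_eq val_inj) /=; lia.
Qed.

(** The same for the interval between the two extreme elements of a block, where
    [nxt P j] is the minimum and [j] the maximum. *)
Lemma hull_closed j x y : y \in pblock P x -> x \notin pblock P j ->
  (nxt P j < x < j)%N -> (nxt P j < y < j)%N.
Proof.
move=> xy xj /andP[nx jx].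
have yj : y \notin pblock P j by move: xy xj; rewrite !pb_eq => /eqP->.
have nj := nxt_in j; have jn : j \in pblock P (nxt P j) by rewrite pb_sym.
have [yltn|ny] := ltnP y (nxt P j).
  have := ncP yltn nx jx; rewrite pb_sym xy jn => /(_ isT isT) h.
  by case/negP: yj; rewrite -pb_nxt pb_sym.
have [jy|yj'] := ltnP j y.
  have := ncP nx jx jy; rewrite jn xy => /(_ isT isT) h.
  by case/negP: xj; rewrite -pb_nxt.
have ne1 : y != j by apply: contraNneq yj => ->; apply: mem_pb.
have ne2 : y != nxt P j by apply: contraNneq yj => ->.
by move: ne1 ne2; rewrite -!(inj_eq val_inj) /=; lia.
Qed.

(** The arc of [j] joins the right point [2j+1] of box [j] to the left point
    [2 (nxt P j)] of the box of its successor. *)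
Definition inside j (p : nat) : bool :=
  (minn j.*2.+1 (nxt P j).*2 < p < maxn j.*2.+1 (nxt P j).*2)%N.

(** The right point of box [i] is joined to the left point of box [nxt P i], so
    that an arc cannot enclose just one of the two. *)
Lemma arcs_noncrossing i j : i != j ->
  inside j i.*2.+1 = inside j (nxt P i).*2.
Proof.
rewrite /inside => ij; have ij' : nat_of_ord i <> j by move/val_inj/eqP; apply/negP.
have nij : nat_of_ord (nxt P i) <> nxt P j.
  by move/val_inj/nxt_inj/eqP; apply/negP.
have ni := nxt_in i; have ni' : i \in pblock P (nxt P i) by rewrite pb_sym.
have [ib|ib] := boolP (i \in pblock P j).
  have nib : nxt P i \in pblock P j by rewrite pb_eq pb_nxt -pb_eq.
  case: (nxtP j) => [[jn h]|[nj h]]; have := h _ ib; have := h _ nib; lia.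
have nib : nxt P i \notin pblock P j by rewrite pb_eq pb_nxt -pb_eq.
have x1 : nat_of_ord i <> nxt P j.
  by move/val_inj => e; move: ib; rewrite e nxt_in.
have x2 : nat_of_ord (nxt P i) <> j.
  by move/val_inj => e; move: nib; rewrite e mem_pb.
case: (nxtP j) => [[jn _]|[nj _]].
  have h1 := gap_closed ni ib jn; have h2 := gap_closed ni' nib jn.
  by apply/idP/idP => h; [have := h1 _|have := h2 _]; lia.
have h1 := hull_closed ni ib; have h2 := hull_closed ni' nib.
by apply/idP/idP => h; [have := h1 _|have := h2 _]; lia.
Qed.

End BlockSuccessor.

(** * Invariance of the tensors of noncrossing partitions *)

Section ArcTensor.
Variables (k : fieldType) (q : k) (n : nat).
Implicit Types (P : {set {set 'I_n}}) (i j : 'I_n).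

(** The factor of the tensor of [P] contributed by the arc at the right point
    of box [j]; every arc arises from exactly one [j]. *)
Definition arc_factor P (s : seq 'I_2) j : k :=
  if (j < nxt P j)%N
  then delta1 q (nth ord0 s j.*2.+1) (nth ord0 s (nxt P j).*2)
  else delta1 q (nth ord0 s (nxt P j).*2) (nth ord0 s j.*2.+1).

Lemma zip_next (T : eqType) (x : T) p : uniq (x :: p) ->
  [seq (z, next (x :: p) z) | z <- x :: p] = zip (x :: p) (rcons p x).
Proof.
move=> up; apply: (@eq_from_nth _ (x, x)).
  by rewrite size_map size1_zip // size_rcons.
rewrite size_map => r ilt; rewrite (nth_map x) // nth_zip ?size_rcons //.
congr (_, _); rewrite next_nth mem_nth // index_uniq // nth_rcons.
by case: ltngtP => // [h|->]; rewrite nth_default // ltnW.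
Qed.

(** All pairs of neighbours in the increasing enumeration of a block are of the
    form [(j, nxt P j)], and so is the pair of its last and first elements. *)
Lemma prod_arcs P (s : seq 'I_2) B : finset.partition P [set: 'I_n] -> B \in P ->
  \prod_(p <- arcs B) delta1 q (nth ord0 s p.1) (nth ord0 s p.2)
    = \prod_(j in B) arc_factor P s j.
Proof.
move=> hP BP; pose G (p : 'I_n * 'I_n) :=
  if (p.1 < p.2)%N then delta1 q (nth ord0 s p.1.*2.+1) (nth ord0 s p.2.*2)
  else delta1 q (nth ord0 s p.2.*2) (nth ord0 s p.1.*2.+1).
have pbB j : j \in B -> pblock P j = B.
  by move=> jB; apply: def_pblock => //; case/and3P: hP.
transitivity (\prod_(p <- [seq (j, next (enum B) j) | j <- enum B]) G p); last first.
  rewrite big_map -big_enum /=; apply: eq_big_seq => j; rewrite mem_enum => jB.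
  by rewrite /arc_factor /nxt pbB.
have := sorted_enum B; have := enum_uniq B; rewrite /arcs.
case eB: (enum B) => [|x p] ul sl.
  case/and3P: hP => _ _; rewrite (_ : finset.set0 = B) ?BP //.
  by apply/setP => y; rewrite inE -mem_enum eB.
have zE : zip (x :: p) (rcons p x) = rcons (zip (belast x p) p) (last x p, x).
  by rewrite lastI zip_rcons ?size_belast.
rewrite zip_next // zE big_rcons big_cons /=.
rewrite mulrC; congr (_ * _); last first.
  rewrite {1}/G /= ltnNge.
  have -> /= : (x <= last x p)%N.
    have := mem_last x p; rewrite inE => /predU1P[->//|lp].
    have := order_path_min (fun _ _ _ => @ltn_trans _ _ _) sl.
    by move/allP/(_ _ lp)/ltnW.
  by rewrite last_map.
rewrite big_map {ul eB BP pbB zE}.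
elim: p x sl => [|y p IHp] x /=; first by rewrite !big_nil.
case/andP=> xy sl; rewrite !big_cons /G /= xy; congr (_ * _).
exact: IHp y sl.
Qed.

Lemma uP_prod P s : finset.partition P [set: 'I_n] ->
  uP q P s = \prod_j arc_factor P s j.
Proof.
move=> hP; rewrite ffunE; case/and3P: (hP) => /eqP cP tP _.
transitivity (\prod_(B in P) \prod_(j in B) arc_factor P s j).
  by apply: eq_bigr => B BP; apply: prod_arcs.
by rewrite -big_trivIset // cP; apply: eq_bigl => j; rewrite inE.
Qed.

End ArcTensor.

Section Invariance.
Variables (k : fieldType) (q : k).
Hypothesis q0 : q != 0.
Hypothesis q_nonroot : forall m, (0 < m)%N -> q ^+ m != 1.

Local Notation dn := (@ord0 1).
Definition up : 'I_2 := Ordinal (isT : 1 < 2)%N.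

Lemma ord2P (P : 'I_2 -> Prop) : P dn -> P up -> forall c, P c.
Proof.
move=> P0 P1 [[|[|c]] //= Hc].
- by rewrite (_ : Ordinal Hc = dn) //; apply: val_inj.
- by rewrite (_ : Ordinal Hc = up) //; apply: val_inj.
Qed.

Lemma big_ord2 (V : nmodType) (G : 'I_2 -> V) : \sum_c G c = G dn + G up.
Proof.
rewrite !big_ord_recl big_ord0 addr0.
by congr (G _ + G _); apply: val_inj.
Qed.

Lemma sliceE1_dn n (x : tens k 1 n.+1) :
  slice (actE q x) dn = q *: actE q (slice x dn).
Proof.
by rewrite /= sliceD !slice_tens_op !big_ord2 !mxE /= !scale0r !add0r addr0.
Qed.

Lemma sliceE1_up n (x : tens k 1 n.+1) :
  slice (actE q x) up = slice x dn + q^-1 *: actE q (slice x up).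
Proof.
rewrite /= sliceD !slice_tens_op !big_ord2 !mxE /= !scale0r !add0r addr0.
by rewrite (qint1 q0 q_nonroot) scale1r.
Qed.

(** Applying $E$ raises one sign at a time, with the power of $q$ coming from
    the factors $K^{-1}$ to its left. *)
Lemma actE1_sum N (Phi : seq 'I_2 -> k) (t : N.-tuple 'I_2) :
  actE q [ffun s : N.-tuple 'I_2 => Phi s] t =
  \sum_(i < N) if nth dn t i == up
    then q ^ (- wt (take i t)) * Phi (set_nth dn t i dn) else 0.
Proof.
elim: N Phi t => [|N IHN] Phi t; first by rewrite big_ord0 ffunE.
case/tupleP: t => c s; rewrite big_ord_recl /= -sliceE.
have sl a : slice [ffun s : N.+1.-tuple 'I_2 => Phi s] a =
            [ffun s : N.-tuple 'I_2 => Phi (a :: s)].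
  by apply/ffunP => r; rewrite !ffunE.
move: c; apply: ord2P.
- rewrite [slice _ _]sliceE1_dn sl ffunE (IHN (fun r => Phi (dn :: r))).
  rewrite /GRing.scale /= mulr_sumr add0r.
  apply: eq_bigr => i _; case: ifP; rewrite ?mulr0 // => _.
  by rewrite wt_cons opprD expfzDr // mulrA.
- rewrite [slice _ _]sliceE1_up !sl !ffunE (IHN (fun r => Phi (up :: r))).
  rewrite /GRing.scale /= mulr_sumr.
  congr (_ + _); first by rewrite /wt big_nil mul1r.
  apply: eq_bigr => i _; case: ifP; rewrite ?mulr0 // => _.
  by rewrite wt_cons opprD expfzDr // mulrA.
Qed.

Definition sgz2 (c : 'I_2) : int := (c.*2)%:Z - 1.

Lemma wt_take N (t : N.-tuple 'I_2) p :
  wt (take p t) = \sum_(r < N) if (r < p)%N then sgz2 (nth dn t r) else 0.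
Proof.
elim: N t p => [|N IHN] t p; first by rewrite big_ord0 tuple0 /wt big_nil.
case/tupleP: t => c s; rewrite big_ord_recl; case: p => [|p] /=.
  by rewrite /wt big_nil big1.
by rewrite wt_cons IHN.
Qed.

Lemma sum_boxes n (V : nmodType) (G : nat -> V) :
  \sum_(r < n.*2) G r = \sum_(j < n) (G j.*2 + G j.*2.+1).
Proof.
elim: n => [|n IHn]; first by rewrite !big_ord0.
by rewrite doubleS !big_ord_recr /= IHn addrA.
Qed.

Lemma sum_arcs n (P : {set {set 'I_n}}) (V : nmodType) (G : nat -> V) :
  finset.partition P [set: 'I_n] ->
  \sum_(r < n.*2) G r = \sum_(j < n) (G (nxt P j).*2 + G j.*2.+1).
Proof.
move=> hP; rewrite sum_boxes !big_split /=; congr (_ + _).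
exact: reindex_inj (nxt_inj hP).
Qed.

Lemma delta1_neq0 a b : delta1 q a b != 0 -> (a + b = 1)%N.
Proof. by move: a b; apply: ord2P; apply: ord2P; rewrite /delta1 /= ?eqxx. Qed.

Lemma arc_factor_neq0 n (P : {set {set 'I_n}}) s j : arc_factor q P s j != 0 ->
  (nth dn s (nxt P j).*2 + nth dn s j.*2.+1 = 1)%N.
Proof.
by rewrite /arc_factor; case: ifP => _ /delta1_neq0; rewrite 1?addnC.
Qed.

Lemma arc_cancel (x y : 'I_2) (A B : int) (R : k) : B = A + sgz2 x ->
  (if y == up then q ^ (- B) * (delta1 q x dn * R) else 0) +
  (if x == up then q ^ (- A) * (delta1 q dn y * R) else 0) = 0.
Proof.
move=> ->; move: x y; apply: ord2P; apply: ord2P; rewrite ?eqxx /=.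
- by rewrite addr0.
- by rewrite /delta1 /= mul0r mulr0 addr0.
- by rewrite /delta1 /= mul0r mulr0 addr0.
rewrite opprD expfzDr // -[q ^ (- sgz2 up)]/(q^-1) /delta1 /=.
by ring.
Qed.

Section Noncrossing.
Variables (n : nat) (P : {set {set 'I_n}}).
Hypothesis hP : finset.partition P [set: 'I_n].
Hypothesis ncP : noncrossing P.

(** The signs at the points enclosed by an arc cancel in pairs, as these points
    are joined by arcs among themselves. *)
Lemma wt_arc (t : n.*2.-tuple 'I_2) (j : 'I_n) (a := minn j.*2.+1 (nxt P j).*2)
    (b := maxn j.*2.+1 (nxt P j).*2) :
  \prod_(i | i != j) arc_factor q P t i != 0 ->
  wt (take b t) = wt (take a t) + sgz2 (nth dn t a).
Proof.
move=> Rn0.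
have alt : (a < n.*2)%N.
  rewrite /a; have := ltn_ord j; have := ltn_ord (nxt P j); rewrite -!muln2; lia.
have ->: sgz2 (nth dn t a) =
    \sum_(r < n.*2) if (r == a :> nat) then sgz2 (nth dn t r) else 0.
  rewrite (bigD1 (Ordinal alt)) //= eqxx big1 ?addr0 // => r ra.
  by rewrite ifN.
apply/eqP; rewrite -subr_eq0 !wt_take -big_split -sumrB /=; apply/eqP.
transitivity (\sum_(r < n.*2) if inside P j r then sgz2 (nth dn t r) else 0).
  apply: eq_bigr => r _; rewrite /inside -/a -/b.
  have ab : (a < b)%N by rewrite /a /b; lia.
  case: (ltngtP r a) => ra /=; case: (ltnP r b) => rb; lia.
rewrite (sum_arcs (fun r => if inside P j r then sgz2 (nth dn t r) else 0) hP).
rewrite big1 // => i _; have [->|ij] := eqVneq i j.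
  rewrite /inside; do 2!case: ifP => //; lia.
rewrite -(arcs_noncrossing hP ncP ij); case: ifP => // _.
have := @arc_factor_neq0 _ P t i; move/prodf_neq0: Rn0 => /(_ i ij) h /(_ h).
by rewrite /sgz2; lia.
Qed.

(** The two ends of an arc contribute opposite terms to $Eu$: raising the sign
    at the left end of $\delta_1$ costs $-q^{-1}$, raising it at the right end
    costs an additional factor $q^{-1}$ from $K^{-1}$. *)
Lemma actE_uP : actE q (uP q P) = 0.
Proof.
have -> : uP q P = [ffun s : n.*2.-tuple 'I_2 => \prod_j arc_factor q P s j].
  by apply/ffunP => s; rewrite uP_prod // ffunE.
apply/ffunP => t; rewrite (actE1_sum (fun s => \prod_j arc_factor q P s j)) ffunE.
set G := fun r : nat => if nth dn t r == up then q ^ (- wt (take r t)) *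
   (\prod_j arc_factor q P (set_nth dn t r dn) j) else 0.
rewrite (sum_arcs G hP) big1 // => j _; rewrite /G.
set R := \prod_(i | i != j) arc_factor q P t i.
have ne i : i != j -> (nxt P i).*2 != (nxt P j).*2.
  by apply: contraNneq => /double_inj/val_inj/nxt_inj->.
have prodE p : p = (nxt P j).*2 \/ p = j.*2.+1 ->
    \prod_i arc_factor q P (set_nth dn t p dn) i =
    arc_factor q P (set_nth dn t p dn) j * R.
  move=> hp; rewrite (bigD1 j) //=; congr (_ * _); apply: eq_bigr => i ij.
  rewrite /arc_factor !nth_set_nth /=; have := ne i ij.
  have ij' : nat_of_ord i <> j by move/val_inj/eqP; apply/negP.
  move=> /eqP ne'.
  have -> : (i.*2.+1 == p) = false by case: hp => ->; apply/eqP; lia.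
  by have -> : ((nxt P i).*2 == p) = false by case: hp => ->; apply/eqP; lia.
rewrite !prodE; [|by right|by left].
have [R0|Rn0] := eqVneq R 0; first by rewrite R0 !mulr0 !if_same addr0.
have := wt_arc Rn0; rewrite /arc_factor !nth_set_nth /= !eqxx.
case: ltnP => jn.
  have [-> ->] : maxn j.*2.+1 (nxt P j).*2 = (nxt P j).*2 /\
                 minn j.*2.+1 (nxt P j).*2 = j.*2.+1 by lia.
  have -> : (j.*2.+1 == (nxt P j).*2) = false by apply/eqP; lia.
  have -> : ((nxt P j).*2 == j.*2.+1) = false by apply/eqP; lia.
  exact: arc_cancel.
have [-> ->] : minn j.*2.+1 (nxt P j).*2 = (nxt P j).*2 /\
                 maxn j.*2.+1 (nxt P j).*2 = j.*2.+1 by lia.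
have -> : (j.*2.+1 == (nxt P j).*2) = false by apply/eqP; lia.
have -> : ((nxt P j).*2 == j.*2.+1) = false by apply/eqP; lia.
by move=> h; rewrite addrC; apply: arc_cancel h.
Qed.

End Noncrossing.

Lemma sum_cons_tuple (T : finType) N (V : nmodType) (G : N.+1.-tuple T -> V) :
  \sum_s G s = \sum_a \sum_(s : N.-tuple T) G [tuple of a :: s].
Proof.
rewrite pair_big /=.
rewrite (reindex (fun p : T * N.-tuple T => [tuple of p.1 :: p.2])) //=.
exists (fun s => (thead s, [tuple of behead s])) => [[a s] _|s _] /=.
  by congr (_, _); apply: val_inj.
by case/tupleP: s => a s; apply: val_inj.
Qed.

Lemma pi2_tensD n (u v : tens k 1 n.*2) :
  pi2_tens q (u + v) = pi2_tens q u + pi2_tens q v.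
Proof.
apply/ffunP => t; rewrite !ffunE -big_split; apply: eq_bigr => s _ /=.
by rewrite ffunE mulrDl.
Qed.

Lemma pi2_tensZ n c (u : tens k 1 n.*2) :
  pi2_tens q (c *: u) = c *: pi2_tens q u.
Proof.
apply/ffunP => t; rewrite !ffunE [RHS]mulr_sumr; apply: eq_bigr => s _ /=.
by rewrite ffunE -mulrA.
Qed.

Lemma pi2_tens0 n : pi2_tens q (0 : tens k 1 n.*2) = 0.
Proof. by apply/ffunP => t; rewrite !ffunE big1 // => s _; rewrite ffunE mul0r. Qed.

Lemma slice_pi2 n (u : tens k 1 n.+1.*2) c :
  slice (pi2_tens q u) c =
  \sum_a \sum_b pi2 q a b c 0 *:
     pi2_tens q (slice (slice (u : tens k 1 n.*2.+2) a) b : tens k 1 n.*2).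
Proof.
apply/ffunP => t; rewrite sliceE ffunE sum_ffunE.
rewrite (@sum_cons_tuple _ n.*2.+1); apply: eq_bigr => a _.
rewrite sum_cons_tuple sum_ffunE; apply: eq_bigr => b _.
rewrite !ffunE [RHS]mulr_sumr; apply: eq_bigr => s _.
rewrite big_ord_recl /= mulrCA !ffunE; congr (_ * _).
congr (_ * _); apply: eq_bigr => j _.
by rewrite !(tnth_nth ord0).
Qed.

Lemma pi2_dd c : pi2 q dn dn c 0 = (c == lo)%:R.
Proof.
rewrite /pi2 /V2dual /= inordK //= mxE eqxx andbT.
by congr (_%:R); rewrite -val_eqE /= inordK.
Qed.

Lemma pi2_uu c : pi2 q up up c 0 = (c == hi)%:R.
Proof.
rewrite /pi2 /V2dual /= inordK //= mxE eqxx andbT.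
by congr (_%:R); rewrite -val_eqE /= inordK.
Qed.

Lemma pi2_du c : pi2 q dn up c 0 = (qint q 2)^-1 * (c == mid)%:R.
Proof.
rewrite /pi2 /V2dual /= inordK //= !mxE eqxx andbT.
by congr (_ * _%:R); rewrite -val_eqE /= inordK.
Qed.

Lemma pi2_ud c : pi2 q up dn c 0 = q^-1 * ((qint q 2)^-1 * (c == mid)%:R).
Proof.
rewrite /pi2 /V2dual /= inordK //= !mxE eqxx andbT.
by congr (_ * (_ * _%:R)); rewrite -val_eqE /= inordK.
Qed.

Lemma slice_pi2_lo n (u : tens k 1 n.+1.*2) (u' : tens k 1 n.*2.+2 := u) :
  slice (pi2_tens q u) lo = pi2_tens q (slice (slice u' dn) dn).
Proof.
rewrite slice_pi2 !big_ord2 pi2_dd pi2_du pi2_ud pi2_uu /= !mulr0.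
by rewrite !scale0r !addr0 scale1r.
Qed.

Lemma slice_pi2_hi n (u : tens k 1 n.+1.*2) (u' : tens k 1 n.*2.+2 := u) :
  slice (pi2_tens q u) hi = pi2_tens q (slice (slice u' up) up).
Proof.
rewrite slice_pi2 !big_ord2 pi2_dd pi2_du pi2_ud pi2_uu /= !mulr0.
by rewrite !scale0r !add0r scale1r.
Qed.

Lemma slice_pi2_mid n (u : tens k 1 n.+1.*2) (u' : tens k 1 n.*2.+2 := u) :
  slice (pi2_tens q u) mid = (qint q 2)^-1 *:
    (pi2_tens q (slice (slice u' dn) up)
       + q^-1 *: pi2_tens q (slice (slice u' up) dn)).
Proof.
rewrite slice_pi2 !big_ord2 pi2_dd pi2_du pi2_ud pi2_uu /= !mulr1.
by rewrite !scale0r add0r addr0 scalerDr scalerA mulrC.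
Qed.

(** By induction on the number of boxes, it is enough to compare components along
    the first copy of $V_2$; the middle one and the top one use $[2]=q+q^{-1}$. *)
Lemma actE_pi2 n (u : tens k 1 n.*2) :
  actE q (pi2_tens q u) = pi2_tens q (actE q u).
Proof.
elim: n u => [|n IHn] u; first by rewrite /= pi2_tens0.
have q2 : q + q^-1 != 0.
  apply: contraNneq (qint_neq0 q0 q_nonroot (isT : 0 < 2)%N) => e.
  by rewrite /qint -exprVn subr_sqr e mulr0 mul0r.
have q2E : qint q 2 = q + q^-1.
  by rewrite /qint -exprVn subr_sqr mulrC mulKf // (qq_neq0 q0 q_nonroot).
have qq : q * q + 1 != 0.
  by apply: contraNneq q2 => e; rewrite -(mulfK q0 (q + q^-1)) mulrDl mulVf // e mul0r.
pose u' : tens k 1 n.*2.+2 := u.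
have Edd : slice (slice (actE q u') dn) dn = q ^+ 2 *: actE q (slice (slice u' dn) dn).
  by rewrite !sliceE1_dn sliceZ sliceE1_dn scalerA.
have Edu : slice (slice (actE q u') dn) up =
    q *: slice (slice u' dn) dn + actE q (slice (slice u' dn) up).
  rewrite !sliceE1_dn sliceZ sliceE1_up scalerDr scalerA divff //.
  by rewrite scale1r.
have Eud : slice (slice (actE q u') up) dn =
    slice (slice u' dn) dn + actE q (slice (slice u' up) dn).
  by rewrite !sliceE1_up sliceD sliceZ sliceE1_dn scalerA mulVf // scale1r.
have Euu : slice (slice (actE q u') up) up =
    slice (slice u' dn) up + (q^-1 *: slice (slice u' up) dn
       + q ^- 2 *: actE q (slice (slice u' up) up)).
  rewrite !sliceE1_up sliceD sliceZ sliceE1_up scalerDr scalerA.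
  by rewrite -exprVn.
apply: slice_ext; apply: ord3P.
- by rewrite sliceE_lo // !slice_pi2_lo IHn Edd pi2_tensZ.
- rewrite sliceE_mid // !slice_pi2_mid slice_pi2_lo Edu Eud !pi2_tensD !pi2_tensZ.
  rewrite actEZ // actED // actEZ // !IHn.
  apply/ffunP => t; rewrite !ffunE q2E.
  by rewrite /GRing.scale /=; field; rewrite q0.
rewrite sliceE_hi // !slice_pi2_hi slice_pi2_mid Euu !pi2_tensD !pi2_tensZ IHn.
by rewrite scalerA divff ?q2E // scale1r addrA.
Qed.
End Invariance.

(** * The leading word of a partition *)

Section LeadingWord.
Variable n : nat.
Implicit Types (P : {set {set 'I_n}}) (j : 'I_n).

Lemma ht_drop (t : n.-tuple 'I_3) l :
  ht (drop l t) = \sum_(j < n) if (l <= j)%N then (tnth t j)%:Z - 1 else 0.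
Proof.
elim: n t l => [|m IHm] t l; first by rewrite big_ord0 tuple0 /ht big_nil.
case/tupleP: t => c s; rewrite big_ord_recl tnth0; case: l => [|l] /=.
  rewrite ht_cons; congr (_ + _); rewrite -{1}[tval s]drop0 IHm.
  by apply: eq_bigr => j _; rewrite tnthS.
by rewrite add0r IHm; apply: eq_bigr => j _; rewrite tnthS.
Qed.

Definition later P j := [exists i in pblock P j, (j < i)%N].
Definition earlier P j := [exists i in pblock P j, (i < j)%N].

(** The index of the leading coefficient of $f^0(P)$, obtained by giving every
    arc its positive sign at the right end: the letter is [lo] at the minimum of
    a block, [hi] at the maximum, and [mid] in between. *)
Definition word P : n.-tuple 'I_3 :=
  [tuple inord (earlier P j + ~~ later P j) | j < n].

Lemma word_val P j : tnth (word P) j = (earlier P j + ~~ later P j)%N :> nat.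
Proof. by rewrite tnth_mktuple inordK //; case: (earlier P j); case: (later P j). Qed.

(** The number of blocks of [P] with elements on both sides of the gap before
    [l], as each of them has a single element [j] with [j < l <= nxt P j]. *)
Definition open_blocks P l := #|[set j : 'I_n | (j < l <= nxt P j)%N]|.

Lemma open_blocksE P l :
  (open_blocks P l)%:Z = \sum_(j < n) ((j < l <= nxt P j)%N : nat)%:Z.
Proof.
rewrite /open_blocks -sum1_card big_mkcond /= (big_morph _ PoszD (erefl _)).
by apply: eq_bigr => j _; rewrite inE; case: ifP.
Qed.

Section Partition.
Variable P : {set {set 'I_n}}.
Hypothesis hP : finset.partition P [set: 'I_n].

Lemma laterE j : later P j = (j < nxt P j)%N.
Proof. by rewrite nxt_gtE. Qed.

Lemma earlier_nxt j : earlier P (nxt P j) = (j < nxt P j)%N.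
Proof.
apply/exists_inP/idP => [[i ij ilt]|jn]; last by exists j; rewrite // pb_sym // nxt_in.
rewrite pb_nxt // in ij; rewrite ltnNge; apply/negP => /(nxt_min hP)/(_ _ ij).
by rewrite leqNgt ilt.
Qed.

Lemma ht_word l : ht (drop l (word P)) = (open_blocks P l)%:Z.
Proof.
rewrite ht_drop open_blocksE.
transitivity (\sum_(j < n) ((if (l <= j)%N then (earlier P j : nat)%:Z else 0)
    - if (l <= j)%N then (later P j : nat)%:Z else 0)).
  apply: eq_bigr => j _; rewrite word_val; case: ifP => // _.
  by case: (earlier P j); case: (later P j).
rewrite sumrB (reindex_inj (nxt_inj hP)) -sumrB; apply: eq_bigr => j _ /=.
rewrite earlier_nxt laterE.
by case: (ltnP j (nxt P j)); case: (leqP l (nxt P j)); case: (leqP l j) => //=; lia.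
Qed.

End Partition.
End LeadingWord.

Section Triangularity.
Variables (k : fieldType) (q : k).
Hypothesis q0 : q != 0.
Hypothesis q_nonroot : forall m, (0 < m)%N -> q ^+ m != 1.
Variables (n : nat) (P : {set {set 'I_n}}).
Hypothesis hP : finset.partition P [set: 'I_n].
Local Notation dn := (@ord0 1).

Lemma pi2_neq0 a b c : (pi2 q a b c 0 != 0) = (c == (a + b)%N :> nat).
Proof.
have q2 := qint_neq0 q0 q_nonroot (isT : 0 < 2)%N.
move: a b c; do 2!apply: ord2P; apply: ord3P;
  rewrite ?pi2_dd ?pi2_du ?pi2_ud ?pi2_uu /= ?mulr0 ?mulr1 ?eqxx ?oner_eq0 //;
  by rewrite ?mulf_neq0 ?invr_eq0 ?q0 ?q2.
Qed.

(** The sign vectors whose term in the coefficient of [t] in $f^0(P)$ may be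
    nonzero: opposite signs at the ends of each arc, and in each box two signs
    that $\pi_2$ maps to a multiple of the letter of [t]. *)
Definition compatible (t : n.-tuple 'I_3) (s : n.*2.-tuple 'I_2) :=
  (forall j, nth dn s (nxt P j).*2 + nth dn s j.*2.+1 = 1)%N /\
  (forall j : 'I_n, nat_of_ord (tnth t j) = nth dn s j.*2 + nth dn s j.*2.+1)%N.

Lemma compatibleP t s :
  uP q P s * \prod_(j < n)
     pi2 q (nth ord0 s j.*2) (nth ord0 s j.*2.+1) (tnth t j) 0 != 0 ->
  compatible t s.
Proof.
rewrite mulf_eq0 negb_or uP_prod // => /andP[/prodf_neq0 h1 /prodf_neq0 h2].
split=> j; first by apply: (@arc_factor_neq0 _ q _ P); apply: h1.
by apply/eqP; rewrite -pi2_neq0 h2.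
Qed.

(** Each arc has opposite signs at its ends, so that only the arcs crossing the
    gap contribute to the height there. *)
Lemma ht_compatible t s l : compatible t s ->
  ht (drop l t) = \sum_j (nth dn s (nxt P j).*2 : nat)%:Z *
    (((l <= nxt P j)%N : nat)%:Z - ((l <= j)%N : nat)%:Z).
Proof.
case=> hs ht; rewrite ht_drop.
transitivity (\sum_(j < n) ((if (l <= j)%N then (nth dn s j.*2 : nat)%:Z else 0) +
    if (l <= j)%N then (nth dn s j.*2.+1 : nat)%:Z - 1 else 0)).
  by apply: eq_bigr => j _; rewrite ht; case: ifP => // _; rewrite PoszD addrA.
rewrite big_split /= (reindex_inj (nxt_inj hP)) -big_split; apply: eq_bigr => j _ /=.
by have := hs j; case: (leqP l (nxt P j)); case: (leqP l j) => //=; lia.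
Qed.

Lemma compatible_le t s l : compatible t s ->
  ht (drop l t) <= (open_blocks P l)%:Z.
Proof.
move=> c; rewrite (ht_compatible l c) open_blocksE; apply: ler_sum => j _.
by have := c.1 j; case: (leqP l (nxt P j)); case: (leqP l j) => //=; lia.
Qed.

Lemma f0_compatible t : f0 q P t != 0 -> exists s, compatible t s.
Proof.
rewrite ffunE => h; have [s _ hs] : exists2 s, s \in predT &
    uP q P s * \prod_(j < n)
      pi2 q (nth ord0 s j.*2) (nth ord0 s j.*2.+1) (tnth t j) 0 != 0.
  apply/exists_inP; apply: contraR h => /exists_inPn h.
  by rewrite big1 // => s _; apply/eqP/negPn/h.
by exists s; apply: compatibleP.
Qed.

Lemma f0_le t l : f0 q P t != 0 -> ht (drop l t) <= ht (drop l (word P)).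
Proof.
by move/f0_compatible => [s c]; rewrite ht_word // (compatible_le _ c).
Qed.

Lemma f0_homog : homog q 0 (f0 q P).
Proof.
apply/homogP => // t /f0_compatible[s c]; rewrite -[tval t]drop0.
by rewrite (ht_compatible 0 c) big1 // => j _; rewrite !leq0n subrr mulr0.
Qed.

Hypothesis no_single : forall j, nxt P j != j.

(** If the heights are the largest possible, each arc has its positive sign at
    its right end. *)
Lemma compatible_word s : compatible (word P) s ->
  forall j, nth dn s (nxt P j).*2 = (j < nxt P j)%N :> nat.
Proof.
move=> c j; pose l := maxn j (nxt P j).
have := ht_compatible l c; rewrite ht_word // open_blocksE => /eqP.
rewrite eq_sym -subr_eq0 -sumrB => /eqP e.
have ne : nat_of_ord (nxt P j) <> j by move/val_inj/eqP; apply/negP.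
have ej : (nth dn s (nxt P j).*2 : nat)%:Z * (((l <= nxt P j)%N : nat)%:Z
     - ((l <= j)%N : nat)%:Z) = ((j < l <= nxt P j)%N : nat)%:Z.
  apply/eqP; rewrite eq_sym -subr_eq0 -oppr_eq0 opprB; move/eqP: e.
  rewrite -oppr_eq0 -sumrN psumr_eq0 => [/allP/(_ j)|i _].
    by rewrite mem_index_enum oppr_eq0 => /(_ isT).
  by have := c.1 i; case: (leqP l (nxt P i)); case: (leqP l i) => //=; lia.
by move: ej; rewrite /l; have := c.1 j; case: ltnP => //=; lia.
Qed.

(** Positive signs exactly at the right ends of the arcs. The default [true] is
    never reached, because [p./2 < n]. *)
Definition word_signs : n.*2.-tuple 'I_2 :=
  [tuple inord (if odd p then ~~ (oapp (later P) true (insub p./2)) : nat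
                else oapp (earlier P) true (insub p./2)) | p < n.*2].

Lemma word_signs_left (j : 'I_n) :
  nth dn word_signs j.*2 = earlier P j :> nat.
Proof.
have jlt : (j.*2 < n.*2)%N by rewrite ltn_double.
rewrite -[j.*2]/(nat_of_ord (Ordinal jlt)) -tnth_nth tnth_mktuple /=.
by rewrite odd_double doubleK valK /= inordK //; case: (earlier P j).
Qed.

Lemma word_signs_right (j : 'I_n) :
  nth dn word_signs j.*2.+1 = ~~ later P j :> nat.
Proof.
have jlt : (j.*2.+1 < n.*2)%N by rewrite -!muln2; have := ltn_ord j; lia.
rewrite -[j.*2.+1]/(nat_of_ord (Ordinal jlt)) -tnth_nth tnth_mktuple /=.
by rewrite odd_double uphalf_double valK /= inordK //; case: (later P j).
Qed.

Lemma compatible_word_uniq s : compatible (word P) s -> s = word_signs.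
Proof.
move=> c; apply: eq_from_tnth => p; apply: val_inj; rewrite !(tnth_nth dn) /=.
have pn : (p./2 < n)%N by rewrite -ltn_double; have := ltn_ord p; lia.
have hs := compatible_word c; rewrite -(odd_double_half p).
rewrite -[p./2]/(nat_of_ord (Ordinal pn)); move: (Ordinal pn) => j.
case: odd => /=; rewrite ?add1n ?add0n.
  by rewrite word_signs_right laterE //; have := c.1 j; rewrite hs; case: ltnP => /=; lia.
rewrite word_signs_left -(f_invF (nxt_inj hP) j).
by rewrite earlier_nxt // hs.
Qed.

(** The leading coefficient is a single product of nonzero factors, as only one
    sign vector reaches the largest heights. *)
Lemma f0_word : f0 q P (word P) != 0.
Proof.
rewrite ffunE (bigD1 word_signs) //= [X in _ + X]big1 ?addr0 => [|s /eqP sw].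
  rewrite mulf_neq0 // ?uP_prod //; apply/prodf_neq0 => j _.
    rewrite /arc_factor; case: ltnP => jn.
      have := word_signs_left (nxt P j); have := word_signs_right j.
      rewrite laterE // earlier_nxt // jn /delta1 => -> -> /=.
      by rewrite oppr_eq0 invr_eq0.
    have := word_signs_left (nxt P j); have := word_signs_right j.
    rewrite laterE // earlier_nxt // ltnNge jn /delta1 => -> -> /=.
    by rewrite oppr_eq0 invr_eq0.
  by rewrite pi2_neq0 word_val word_signs_left word_signs_right.
by apply/eqP/negPn/negP => /compatibleP/compatible_word_uniq.
Qed.

End Triangularity.

(** * Partitions and words determine each other *)

Section WordsOfPartitions.
Variable n : nat.
Implicit Types (P : {set {set 'I_n}}) (t : n.-tuple 'I_3) (i j : 'I_n).

Lemma goodP t : reflect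
  (forall j, tnth t j != hi -> 1 <= ht (drop j.+1 t)) (good t).
Proof.
rewrite (_ : good t = [forall j : 'I_n, (tnth t j == hi) || (1 <= ht (drop j.+1 t))]).
  by apply: (iffP forallP) => h j; have := h j; case: eqP => //= _; apply.
elim: n t => [|m IHm] t; first by rewrite tuple0 /=; apply/esym/forallP => -[].
case/tupleP: t => c s; rewrite [good _]/= IHm.
apply/andP/forallP => [[/forallP h1 h2] j|h].
  case: (unliftP ord0 j) => [j' ->|->]; first by rewrite tnthS; apply: h1.
  by rewrite tnth0 /= drop0.
split; last by have := h ord0; rewrite tnth0 /= drop0.
by apply/forallP => j; have := h (lift ord0 j); rewrite tnthS.
Qed.

Lemma good_ht_ge0 (s : seq 'I_3) : good s -> 0 <= ht s.
Proof.
elim: s => [|c s IHs]; first by rewrite /ht big_nil.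
by rewrite ht_cons /= => /andP[/IHs h /predU1P[->|h']] /=; lia.
Qed.

Lemma good_drop (s : seq 'I_3) l : good s -> good (drop l s).
Proof.
elim: s l => [|c s IHs] [|l] //= /andP[gs _]; exact: IHs.
Qed.

Lemma ht_drop_step t (j : 'I_n) :
  ht (drop j t) = (tnth t j)%:Z - 1 + ht (drop j.+1 t).
Proof.
by rewrite (drop_nth hi) ?size_tuple // ht_cons (tnth_nth hi).
Qed.

(** The height just before or just after the letter, whichever is larger: the
    number of blocks spanning position [j], for the word of a partition. *)
Definition level t j : int := ht (drop j.+1 t) + ((tnth t j == hi) : nat)%:Z.

(** Positions of equal level between which the height never drops below that
    level. Reading [lo] and [hi] as opening and closing brackets, these are the
    matching brackets together with the letters [mid] directly inside them. *)
Definition same_level t i j : bool :=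
  (level t i == level t j) &&
  [forall l : 'I_n, (minn i j < l <= maxn i j)%N ==> (level t i <= ht (drop l t))].

Definition partition_of t := equivalence_partition (same_level t) [set: 'I_n].

Lemma same_levelP t i j : (i <= j)%N -> reflect
  (level t i = level t j /\
   forall l : nat, (i < l <= j)%N -> level t i <= ht (drop l t))
  (same_level t i j).
Proof.
move=> ij; rewrite /same_level (minn_idPl ij) (maxn_idPr ij).
apply: (iffP andP) => [[/eqP-> /forallP h]|[-> h]].
  split=> // l il; have ln : (l < n)%N by have := ltn_ord j; lia.
  by have /implyP := h (Ordinal ln); apply.
by split=> //; apply/forallP => l; apply/implyP; apply: h.
Qed.

Lemma same_level_sym t i j : same_level t i j = same_level t j i.
Proof.
rewrite /same_level minnC maxnC eq_sym; case: eqP => //= ->.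
by [].
Qed.

Lemma same_level_trans t i j l :
  same_level t i j -> same_level t j l -> same_level t i l.
Proof.
move=> /andP[/eqP e1 /forallP h1] /andP[/eqP e2 /forallP h2].
apply/andP; split; first by rewrite e1 e2.
apply/forallP => m; apply/implyP => hm.
have := implyP (h1 m); have := implyP (h2 m); rewrite -e1.
have [//|ni h _] := boolP (minn i j < m <= maxn i j)%N; first by move=> _ _ /(_ isT).
by apply: h; lia.
Qed.

Lemma same_level_equiv t : {in [set: 'I_n] & &, equivalence_rel (same_level t)}.
Proof.
move=> i j l _ _ _; split=> [|ij].
  by rewrite /same_level eqxx /=; apply/forallP => m; apply/implyP; lia.
apply/idP/idP; first by apply: same_level_trans; rewrite same_level_sym.
exact: same_level_trans.
Qed.

Lemma mem_partition_of t i j : (j \in pblock (partition_of t) i) = same_level t i j.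
Proof. by rewrite pblock_equivalence_partition //; apply: same_level_equiv. Qed.

Lemma partition_of_partition t : finset.partition (partition_of t) [set: 'I_n].
Proof. exact/equivalence_partitionP/same_level_equiv. Qed.

Lemma level_notlo t j : tnth t j != lo -> level t j = ht (drop j t).
Proof.
rewrite ht_drop_step /level; move: (tnth t j); apply: ord3P => //= _; lia.
Qed.

Lemma level_nothi t j : tnth t j != hi -> level t j = ht (drop j.+1 t).
Proof. by rewrite /level => /negPf ->; rewrite addr0. Qed.

(** If [a], [c] and [b], [d] are in the same classes with [a < b < c < d], then
    each of the two levels is at least the other. *)
Lemma partition_of_noncrossing t : noncrossing (partition_of t).
Proof.
move=> a b c d ab bc cd; rewrite !mem_partition_of.
move/(same_levelP _ (ltnW (ltn_trans ab bc))) => [e1 h1].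
move/(same_levelP _ (ltnW (ltn_trans bc cd))) => [e2 h2].
apply/(same_levelP _ (ltnW ab)); split; last by move=> l hl; apply: h1; lia.
have := h1 b.+1; have := h2 c.+1; have : level t b >= ht (drop b.+1 t).
  by rewrite /level; lia.
have : level t c >= ht (drop c.+1 t) by rewrite /level; lia.
by move: e1 e2 ab bc cd; clear; lia.
Qed.

Section GoodWord.
Variable t : n.-tuple 'I_3.
Hypothesis gt : good t.
Hypothesis ht0 : ht t = 0.

Let ht_n : ht (drop n t) = 0.
Proof. by rewrite drop_oversize ?size_tuple // /ht big_nil. Qed.

Let ht_ge0 l : 0 <= ht (drop l t).
Proof. exact/good_ht_ge0/good_drop. Qed.

(** A letter other than [hi] is followed by a letter of its block, at the
    first later position where the height drops below its level. *)
Lemma later_partition_of i : later (partition_of t) i = (tnth t i != hi).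
Proof.
apply/exists_inP/idP => [[j]|ti].
  rewrite mem_partition_of => ij ilt; apply/eqP => ti.
  have [_ h] := same_levelP _ (ltnW ilt) ij.
  have := h i.+1; rewrite /level ti eqxx; lia.
have L1 := goodP _ gt _ ti; have Li := level_nothi ti; rewrite -Li in L1.
pose Q (l : nat) := (i < l < n)%N && (ht (drop l.+1 t) < level t i).
have ex : exists l, Q l.
  have i1 : (i.+1 < n)%N.
    have := ltn_ord i; rewrite leq_eqVlt => /predU1P[e|//].
    by move: L1; rewrite Li e ht_n.
  exists n.-1; rewrite /Q; have n0 : (0 < n)%N by lia.
  by rewrite prednK // ht_n; apply/andP; split; lia.
case: (ex_minnP ex) => m /andP[/andP[im mn] hm] mmin.
have ge l : (i < l <= m)%N -> level t i <= ht (drop l t).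
  move=> /andP[il lm]; case: l il lm => // l il lm.
  have [<-|ne] := eqVneq (nat_of_ord i) l; first by rewrite Li.
  rewrite leNgt; apply/negP => hl; have := mmin l; rewrite /Q hl andbT.
  have : nat_of_ord i <> l by apply/eqP.
  by lia.
exists (Ordinal mn); rewrite ?mem_partition_of //.
apply/(same_levelP _ (ltnW im : (i <= Ordinal mn)%N)); split => //=.
rewrite [RHS]/level; have := ge m; rewrite im leqnn => /(_ isT).
have := ht_drop_step t (Ordinal mn); move: hm => /=.
by move: (tnth t (Ordinal mn)) (level t i); apply: ord3P => L /=; lia.
Qed.

(** A letter other than [lo] is preceded by a letter of its block, at the last
    earlier position where the height is below its level. *)
Lemma earlier_partition_of i : earlier (partition_of t) i = (tnth t i != lo).
Proof.
apply/exists_inP/idP => [[j]|ti].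
  rewrite mem_partition_of same_level_sym => ji jlt; apply/eqP => ti.
  have [e h] := same_levelP _ (ltnW jlt) ji.
  have := h i; rewrite e /level ti ht_drop_step ti /=; lia.
have Li := level_notlo ti.
have L1 : 1 <= level t i.
  have [tih|tih] := eqVneq (tnth t i) hi.
    by rewrite /level tih eqxx; have := ht_ge0 i.+1; lia.
  by rewrite level_nothi //; apply: (goodP _ gt).
pose Q (l : nat) := (l < i)%N && (ht (drop l t) < level t i).
have ex : exists l, Q l.
  exists 0%N; rewrite /Q drop0 ht0; apply/andP; split; last by lia.
  rewrite lt0n; apply/negP => /eqP i0; move: L1.
  by rewrite Li i0 drop0 ht0.
have bnd l : Q l -> (l <= i)%N by case/andP=> /ltnW.
case: (ex_maxnP ex bnd) => m /andP[mi hm] mmax.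
have mn : (m < n)%N by apply: ltn_trans mi _.
have ge l : (m < l <= i)%N -> level t i <= ht (drop l t).
  move=> /andP[ml]; rewrite leq_eqVlt => /predU1P[->|li]; first by rewrite Li.
  rewrite leNgt; apply/negP => hl; have := mmax l; rewrite /Q hl li => /(_ isT).
  by lia.
have Lm : level t (Ordinal mn) = level t i.
  rewrite [LHS]/level; have := ge m.+1; rewrite ltnSn mi => /(_ isT).
  have := ht_drop_step t (Ordinal mn); move: hm => /=.
  by move: (tnth t (Ordinal mn)) (level t i); apply: ord3P => L /=; lia.
exists (Ordinal mn); rewrite ?mem_partition_of //.
rewrite same_level_sym; apply/(same_levelP _ (ltnW mi : (Ordinal mn <= i)%N)).
by split => //= l hl; rewrite Lm; apply: ge.
Qed.

Lemma word_partition_of : word (partition_of t) = t.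
Proof.
apply: eq_from_tnth => j; apply: val_inj; rewrite /= word_val.
rewrite earlier_partition_of later_partition_of.
by move: (tnth t j); apply: ord3P.
Qed.

Lemma card_partition_of B : B \in partition_of t -> (1 < #|B|)%N.
Proof.
move=> BP; have hP := partition_of_partition t.
case/and3P: (hP) => _ tP P0.
have [B0|[i iB]] := set_0Vmem B; first by rewrite -B0 BP in P0.
have pB := def_pblock tP BP iB.
have : exists2 j, j \in B & j != i.
  have [ti|ti] := eqVneq (tnth t i) hi.
    have : earlier (partition_of t) i by rewrite earlier_partition_of ti.
    case/exists_inP => j; rewrite pB => jB ji; exists j => //.
    by rewrite -(inj_eq val_inj) /=; lia.
  have : later (partition_of t) i by rewrite later_partition_of.
  case/exists_inP => j; rewrite pB => jB ji; exists j => //.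
  by rewrite -(inj_eq val_inj) /=; lia.
by case=> j jB ji; apply/card_gt1P; exists i, j; split; rewrite // eq_sym.
Qed.

End GoodWord.

Section Uniqueness.
Variable P : {set {set 'I_n}}.
Hypothesis hP : finset.partition P [set: 'I_n].
Hypothesis ncP : noncrossing P.
Hypothesis cardP : forall B, B \in P -> (1 < #|B|)%N.

Lemma nxt_neq j : nxt P j != j.
Proof.
apply/eqP => e; have := cardP (pblock_mem (x := j) (P := P) _).
rewrite (cover_partition hP) inE => /(_ isT)/card_gt1P[x [y [xj yj]]].
have h c : c \in pblock P j -> c = j.
  have := nxt_min hP (j := j); rewrite e leqnn => /(_ isT c) h /h hc.
  by apply: val_inj => /=; lia.
by rewrite (h _ xj) (h _ yj) eqxx.
Qed.

Lemma ht_word0 : ht (word P) = 0.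
Proof.
by rewrite -[tval (word P)]drop0 ht_word // open_blocksE big1.
Qed.

Lemma good_word : good (word P).
Proof.
apply/goodP => j; rewrite -(inj_eq val_inj) /= word_val ht_word // => hj.
have jn : (j < nxt P j)%N.
  rewrite -laterE //; move: hj.
  have : later P j || earlier P j.
    rewrite laterE //; case: ltnP => //= nj.
    apply/exists_inP; exists (nxt P j); first exact: nxt_in.
    by rewrite ltn_neqAle nj andbT (inj_eq val_inj) nxt_neq.
  by case: (later P j) => //= ->.
rewrite lez_nat card_gt0; apply/set0Pn; exists j.
by rewrite inE ltnSn.
Qed.

(** The blocks open at the gap after [i] are those open at the gap before its
    successor, and none of them closes in between, since blocks do not cross. *)
Lemma same_level_nxt i : (i < nxt P i)%N -> same_level (word P) i (nxt P i).
Proof.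
move=> ii; apply/(same_levelP _ (ltnW ii)).
pose op (l : nat) := [set k : 'I_n | (k < l <= nxt P k)%N].
have sub l : (i < l <= nxt P i)%N -> op i.+1 \subset op l.
  move=> hl; apply/subsetP => k; rewrite !inE => /andP[ki ink].
  have [->|ne] := eqVneq k i; first by lia.
  have ki' : (k < i)%N by rewrite ltn_neqAle (inj_eq val_inj) ne.
  rewrite leqNgt; have [|h] := ltnP (nxt P k) (nxt P i); last by lia.
  move=> lt; have := ncP ki' ink lt; rewrite !nxt_in // => /(_ isT isT).
  by move/(nxt_max hP (ltn_trans ki' ink)); lia.
have sub' : op (nxt P i) \subset op i.+1.
  apply/subsetP => k; rewrite !inE => /andP[ki ink].
  have [->|ne] := eqVneq k i; first by lia.
  have nki : nat_of_ord (nxt P k) <> nxt P i.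
    by move/val_inj/(nxt_inj hP)/eqP; apply/negP.
  rewrite leqNgt; have [ik|h] := ltnP i k; last by lia.
  have lt : (nxt P i < nxt P k)%N by lia.
  have := ncP ik ki lt; rewrite !nxt_in // => /(_ isT isT).
  by move/(nxt_max hP ii); lia.
have h1 : level (word P) i = (open_blocks P i.+1)%:Z.
  rewrite level_nothi ?ht_word // -(inj_eq val_inj) /= word_val laterE // ii.
  by case: earlier.
have h2 : level (word P) (nxt P i) = (open_blocks P (nxt P i))%:Z.
  rewrite level_notlo ?ht_word // -(inj_eq val_inj) /= word_val earlier_nxt // ii.
  by [].
split=> [|l hl]; last by rewrite h1 ht_word // lez_nat subset_leq_card ?sub.
rewrite h1 h2; congr (_%:Z); apply/eqP; rewrite eqn_leq !subset_leq_card //.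
by rewrite sub // ii leqnn.
Qed.

Lemma same_block_level i j : j \in pblock P i -> same_level (word P) i j.
Proof.
have refl l : same_level (word P) l l.
  by have [] := @same_level_equiv (word P) l l l (in_setT _) (in_setT _) (in_setT _).
wlog ij : i j / (i <= j)%N.
  move=> h; case: (leqP i j) => [|/ltnW] ij; first exact: h.
  by rewrite pb_sym // same_level_sym; apply: h.
move: {2}(j - i)%N (leqnn (j - i)) => d; elim: d i ij => [|d IHd] i ij dij jb.
  by rewrite (_ : i = j) //; apply: val_inj => /=; lia.
have [->//|ne] := eqVneq i j.
have ij' : (i < j)%N by rewrite ltn_neqAle (inj_eq val_inj) ne.
have ii : (i < nxt P i)%N.
  by rewrite nxt_gtE //; apply/exists_inP; exists j.
have nj : (nxt P i <= j)%N by have := nxt_max hP ii jb; lia.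
apply: same_level_trans (same_level_nxt ii) _.
by apply: IHd => //; [lia | rewrite pb_nxt].
Qed.

Lemma pblock_min i : exists2 m, m \in pblock P i & ~~ earlier P m.
Proof.
case: (arg_minnP (fun m : 'I_n => nat_of_ord m) (mem_pb hP i)) => m mi hm.
exists m => //; apply/exists_inPn => j; rewrite -leqNgt => jm; apply: hm.
by have mi' : m \in pblock P i := mi; move: mi' jm; rewrite pb_eq // => /eqP <-.
Qed.

(** [P] refines the partition of its word, and a block of the latter contains
    only one letter [lo], while each block of [P] contains one. *)
Lemma partition_of_word : partition_of (word P) = P.
Proof.
rewrite -[RHS](equivalence_partition_pblock hP); congr equivalence_partition.
apply/funext => i; apply/funext => j; apply/idP/idP; last exact: same_block_level.
move=> ij; have [i0 ii0 ei] := pblock_min i; have [j0 jj0 ej] := pblock_min j.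
have lo0 m : ~~ earlier P m -> tnth (word P) m = lo.
  move=> em; apply: val_inj; rewrite /= word_val (negPf em) laterE //.
  case: ltnP => // nm; case/exists_inP: em.
  exists (nxt P m); rewrite ?nxt_in //.
  by rewrite ltn_neqAle nm andbT (inj_eq val_inj) nxt_neq.
have R00 : same_level (word P) i0 j0.
  apply: same_level_trans (same_block_level jj0).
  apply: same_level_trans ij; rewrite same_level_sym; exact: same_block_level.
have uniq x y : same_level (word P) x y -> ~~ earlier P x -> ~~ earlier P y ->
    ~~ (x < y)%N.
  move=> xy ex ey; apply/negP => lt.
  have := earlier_partition_of good_word ht_word0 y.
  rewrite lo0 // eqxx => /negbT/exists_inP; case; exists x => //.
  by rewrite mem_partition_of same_level_sym.
have e00 : i0 = j0.
  apply: val_inj => /=; have := uniq _ _ R00 ei ej; rewrite same_level_sym in R00.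
  by have := uniq _ _ R00 ej ei; lia.
by move: ii0 jj0; rewrite e00 !pb_eq // => /eqP-> /eqP->.
Qed.

End Uniqueness.
End WordsOfPartitions.

(** * Convex hulls on the circle *)

Section CircleHulls.
Variables (R : realType) (n : nat).
Implicit Types (P : {set {set 'I_n}}) (A B : {set 'I_n}) (a b c d i j : 'I_n).

Lemma circle_den_neq0 (x : R) : 1 + x ^+ 2 != 0.
Proof. by rewrite gt_eqF // ltr_wpDr ?sqr_ge0. Qed.

Lemma segment_hull B a b (u v : R) : a \in B -> b \in B -> a != b ->
  0 <= u -> 0 <= v -> u + v = 1 ->
  circle_hull R B (u * (circle_pt R a).1 + v * (circle_pt R b).1,
                   u * (circle_pt R a).2 + v * (circle_pt R b).2).
Proof.
move=> aB bB ab u0 v0 uv; pose w j := if j == a then u else if j == b then v else 0.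
have wsum (G : 'I_n -> R) : \sum_(j in B) w j * G j = u * G a + v * G b.
  rewrite (bigD1 a) //= (bigD1 b) /=; last by rewrite bB eq_sym.
  rewrite /w eqxx (eq_sym b) (negPf ab) eqxx big1 ?addr0 // => j.
  by case/andP => /andP[_ /negPf->] /negPf->; rewrite mul0r.
exists w; split=> //=; first by move=> j; rewrite /w; do 2?case: ifP.
have := wsum (fun=> 1); rewrite !mulr1 uv => <-.
by apply: eq_bigr => j _; rewrite mulr1.
Qed.

(** The vanishing third divided difference of a quadratic polynomial, with its
    terms sorted by sign. *)
Lemma divided_difference (al be ga xa xb xc xd : R)
    (N := fun x : R => al + be * x + ga * x ^+ 2) :
  xb - xa != 0 -> xc - xa != 0 -> xd - xa != 0 -> xc - xb != 0 ->
  xd - xb != 0 -> xd - xc != 0 ->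
  N xa / ((xb - xa) * (xc - xa) * (xd - xa)) +
  N xc / ((xc - xa) * (xc - xb) * (xd - xc)) =
  N xb / ((xb - xa) * (xc - xb) * (xd - xb)) +
  N xd / ((xd - xa) * (xd - xb) * (xd - xc)).
Proof.
move=> h1 h2 h3 h4 h5 h6; rewrite /N; field.
by rewrite h1 h2 h3 h4 h5 h6.
Qed.

Lemma chords_meet A B a b c d : (a < b)%N -> (b < c)%N -> (c < d)%N ->
  a \in A -> c \in A -> b \in B -> d \in B ->
  (circle_hull R A `&` circle_hull R B)%classic <> classical_sets.set0.
Proof.
move=> ab bc cd aA cA bB dB.
have ac : a != c by rewrite -(inj_eq val_inj) neq_ltn /= (ltn_trans ab bc).
have bd : b != d by rewrite -(inj_eq val_inj) neq_ltn /= (ltn_trans bc cd).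
pose t (j : 'I_n) : R := (nat_of_ord j)%:R.
have lt i j : (i < j)%N -> 0 < t j - t i by move=> ij; rewrite subr_gt0 ltr_nat.
have gtab := lt _ _ ab; have gtbc := lt _ _ bc; have gtcd := lt _ _ cd.
have gtac := lt _ _ (ltn_trans ab bc); have gtbd := lt _ _ (ltn_trans bc cd).
have gtad := lt _ _ (ltn_trans ab (ltn_trans bc cd)).
pose ea := ((t b - t a) * (t c - t a) * (t d - t a)).
pose eb := ((t b - t a) * (t c - t b) * (t d - t b)).
pose ec := ((t c - t a) * (t c - t b) * (t d - t c)).
pose ed := ((t d - t a) * (t d - t b) * (t d - t c)).
have DD al be ga (N := fun x : R => al + be * x + ga * x ^+ 2) :
    N (t a) / ea + N (t c) / ec = N (t b) / eb + N (t d) / ed.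
  by apply: divided_difference; rewrite gt_eqF.
have ea0 : 0 < ea by rewrite !mulr_gt0.
have eb0 : 0 < eb by rewrite !mulr_gt0.
have ec0 : 0 < ec by rewrite !mulr_gt0.
have ed0 : 0 < ed by rewrite !mulr_gt0.
pose m j e := (1 + t j ^+ 2) / e.
have m0 j e : 0 < e -> 0 < m j e.
  by move=> e0; rewrite divr_gt0 // ltr_wpDr ?sqr_ge0.
have mx j e : m j e * (circle_pt R j).1 = (1 - t j ^+ 2) / e.
  by rewrite /m /circle_pt /= mulrC mulrA divfK // circle_den_neq0.
have my j e : m j e * (circle_pt R j).2 = (2 * t j) / e.
  by rewrite /m /circle_pt /= mulrC mulrA divfK // circle_den_neq0.
pose S := m a ea + m c ec; have S0 : 0 < S by rewrite addr_gt0 ?m0.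
have Sn : S != 0 by rewrite gt_eqF.
have eS : S = m b eb + m d ed.
  by rewrite /S /m; have := DD 1 0 1; rewrite /= !mul0r !addr0 !mul1r.
have exE : m a ea * (circle_pt R a).1 + m c ec * (circle_pt R c).1 =
           m b eb * (circle_pt R b).1 + m d ed * (circle_pt R d).1.
  by rewrite !mx; have := DD 1 0 (-1); rewrite /= !mul0r !addr0 !mulN1r.
have eyE : m a ea * (circle_pt R a).2 + m c ec * (circle_pt R c).2 =
           m b eb * (circle_pt R b).2 + m d ed * (circle_pt R d).2.
  by rewrite !my; have := DD 0 2 0; rewrite /= !mul0r !addr0 !add0r.
have sc x y z w : x / S * z + y / S * w = (x * z + y * w) / S.
  by rewrite mulrDl -!mulrA ![S^-1 * _]mulrC.
have d0 j e : 0 < e -> 0 <= m j e / S by move=> e0; apply/ltW/divr_gt0 => //; apply: m0.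
have hA := segment_hull aA cA ac (d0 a _ ea0) (d0 c _ ec0).
have hB := segment_hull bB dB bd (d0 b _ eb0) (d0 d _ ed0).
rewrite -!mulrDl -/S divff // !sc exE eyE in hA.
rewrite -!mulrDl -eS divff // !sc in hB.
move=> /seteqP[h _]; exact: (h _ (conj (hA erefl) (hB erefl))).
Qed.

Lemma riordan_noncrossing P : riordan_partition R P -> noncrossing P.
Proof.
case=> hP _ disj a b c d ab bc cd ac bd; apply/negPn/negP => nab.
have inP j : pblock P j \in P by rewrite pblock_mem // (cover_partition hP) inE.
have ne : pblock P a != pblock P b by rewrite -pb_eq.
have := disj _ _ (inP a) (inP b) ne.
by apply: (chords_meet ab bc cd); rewrite ?mem_pb.
Qed.

(** Affine functions on the plane restrict to the points of the circle as
    quadratic polynomials in the index, divided by [1 + j ^+ 2]. *)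
Lemma hull_functional (al be ga : R) B z (Q := fun x : R => al + be * x + ga * x ^+ 2) :
  circle_hull R B z -> exists c : 'I_n -> R,
    [/\ forall j, 0 <= c j, \sum_(j in B) c j = 1 &
      al * ((1 + z.1) / 2) + be * (z.2 / 2) + ga * ((1 - z.1) / 2) =
      \sum_(j in B) c j * (Q (nat_of_ord j)%:R / (1 + (nat_of_ord j)%:R ^+ 2))].
Proof.
case=> c [c0 c1 -> ->]; exists c; split=> //.
set z1 := \sum_(j in B) _; set z2 := \sum_(j in B) _.
have -> : al * ((1 + z1) / 2) + be * (z2 / 2) + ga * ((1 - z1) / 2) =
    (al + ga) / 2 * (\sum_(j in B) c j) + (al - ga) / 2 * z1 + be / 2 * z2.
  by rewrite c1; field.
rewrite /z1 /z2 !mulr_sumr -!big_split /=.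
apply: eq_bigr => j _; rewrite /circle_pt /Q /=; have := circle_den_neq0 (nat_of_ord j)%:R.
by move: (nat_of_ord j)%:R => x den; field; rewrite den.
Qed.

(** A quadratic polynomial with opposite signs on the two sets of indices is an
    affine function that separates the two hulls. *)
Lemma separated_hulls (al be ga : R) A B (Q := fun x : R => al + be * x + ga * x ^+ 2) :
  (forall j, j \in A -> 0 <= Q (nat_of_ord j)%:R) ->
  (forall j, j \in B -> Q (nat_of_ord j)%:R < 0) ->
  (circle_hull R A `&` circle_hull R B)%classic = classical_sets.set0.
Proof.
move=> hA hB; apply/seteqP; split=> // z [zA zB].
have [c [c0 c1 eA]] := hull_functional al be ga zA.
have [d [d0 d1 eB]] := hull_functional al be ga zB.
have den (j : 'I_n) : 0 < 1 + (nat_of_ord j)%:R ^+ 2 :> R.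
  by rewrite ltr_wpDr ?sqr_ge0.
pose w (j : 'I_n) : R := Q (nat_of_ord j)%:R / (1 + (nat_of_ord j)%:R ^+ 2).
have pos j : j \in B -> 0 < - w j.
  by move=> jB; rewrite oppr_gt0 pmulr_llt0 ?invr_gt0 ?hB.
have pos' j : j \in B -> 0 <= d j * - w j.
  by move=> jB; rewrite mulr_ge0 // ltW ?pos.
have eN : \sum_(j in B) d j * - w j = - \sum_(j in B) d j * w j.
  by rewrite -sumrN; apply: eq_bigr => j _; rewrite mulrN.
have : \sum_(j in B) d j * - w j = 0.
  apply/eqP; rewrite eq_le sumr_ge0 // andbT eN oppr_le0 -eB eA.
  by apply: sumr_ge0 => j jA; rewrite mulr_ge0 // divr_ge0 ?hA // ltW.
move/eqP; rewrite psumr_eq0 => [/allP h|]; last by [].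
have /eqP := d1; rewrite big1 => [|j jB]; first by rewrite eq_sym oner_eq0.
have := h j (mem_index_enum _); rewrite jB /= mulf_eq0 => /orP[/eqP//|].
by rewrite gt_eqF ?pos.
Qed.

Section Noncrossing.
Variable P : {set {set 'I_n}}.
Hypothesis hP : finset.partition P [set: 'I_n].
Hypothesis ncP : noncrossing P.

(** If an element of [B] lies between elements of another block, then all of [B]
    lies between two consecutive elements [j], [j'] of that block, and the
    polynomial $(t-j)(t-j')$ separates the hulls. *)
Lemma nested_hulls A B a a' b : A \in P -> B \in P -> A != B ->
  a \in A -> a' \in A -> b \in B -> (a < b)%N -> (b < a')%N ->
  (circle_hull R A `&` circle_hull R B)%classic = classical_sets.set0.
Proof.
move=> AP BP AB aA aA' bB ab ba'; have tP : finset.trivIset P by case/and3P: hP.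
have pos : (a \in A) && (a < b)%N by rewrite aA ab.
case: (@arg_maxnP _ a (fun j => (j \in A) && (j < b)%N) (@nat_of_ord n) pos)
  => j /andP[jA jb] jmax.
have pA := def_pblock tP AP jA; have pB := def_pblock tP BP bB.
have bA : b \notin A by rewrite -pA pb_eq // pA pB.
have jn : (j < nxt P j)%N.
  by rewrite nxt_gtE // pA; apply/exists_inP; exists a' => //; apply: ltn_trans ba'.
have nA : nxt P j \in A by rewrite -pA nxt_in.
have bn : (b < nxt P j)%N.
  rewrite ltn_neqAle leqNgt; apply/andP; split.
    by apply: contraNneq bA => /val_inj ->.
  apply/negP => nb; have := jmax (nxt P j); rewrite nA nb => /(_ isT) /=.
  by rewrite leqNgt jn.
have QE (x : 'I_n) : (j * nxt P j)%N%:R + - (j + nxt P j)%N%:R * (nat_of_ord x)%:R +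
    1 * (nat_of_ord x)%:R ^+ 2 =
    ((nat_of_ord x)%:R - (nat_of_ord j)%:R) *
    ((nat_of_ord x)%:R - (nat_of_ord (nxt P j))%:R) :> R.
  by rewrite natrM natrD; ring.
apply: (separated_hulls (al := (j * nxt P j)%N%:R)
  (be := - (j + nxt P j)%N%:R) (ga := 1)) => x; rewrite QE => xX.
  rewrite -pA in xX; case/orP: (nxt_max hP jn xX) => le.
    rewrite mulr_le0 // subr_le0 ler_nat //.
    exact: leq_trans le (ltnW jn).
  rewrite mulr_ge0 // subr_ge0 ler_nat //.
  exact: leq_trans (ltnW jn) le.
have xb : x \in pblock P b by rewrite pB.
have bj : b \notin pblock P j by rewrite pA.
have /andP[jx xn] := gap_closed hP ncP xb bj jn (introT andP (conj jb bn)).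
by rewrite pmulr_rlt0 ?subr_gt0 ?subr_lt0 ?ltr_nat.
Qed.

(** Either one block has an element between elements of the other, or all
    elements of one block precede all elements of the other and a linear
    polynomial separates the hulls. *)
Lemma disjoint_hulls A B : A \in P -> B \in P -> A != B ->
  (circle_hull R A `&` circle_hull R B)%classic = classical_sets.set0.
Proof.
move=> AP BP AB; have tP : finset.trivIset P by case/and3P: hP.
have ne C D x y : C \in P -> D \in P -> C != D -> x \in C -> y \in D ->
    nat_of_ord x <> y.
  move=> CP DP CD xC yD /val_inj e; case/eqP: CD.
  by rewrite -(def_pblock tP CP xC) -(def_pblock tP DP yD) e.
have nonempty C : C \in P -> exists x, x \in C.
  move=> CP; apply/set0Pn; apply/eqP => C0; case/and3P: hP => _ _.
  by rewrite -C0 CP.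
have [a0 a0A] := nonempty A AP; have [b0 b0B] := nonempty B BP.
wlog ab0 : A B AP BP AB a0 b0 a0A b0B / (a0 < b0)%N.
  move=> h; case: (ltngtP a0 b0) => c; first exact: h c.
    by rewrite classical_sets.setIC; apply: h c; rewrite // eq_sym.
  by case: (ne _ _ _ _ AP BP AB a0A b0B c).
have [|] := boolP [exists a in A, b0 < a]%N.
  by case/exists_inP=> a aA ba; apply: (nested_hulls AP BP AB a0A aA b0B).
move/exists_inPn => hA.
have [|] := boolP [exists b in B, b < a0]%N.
  case/exists_inP=> b bB ba; rewrite classical_sets.setIC.
  by apply: (nested_hulls BP AP _ bB b0B a0A); rewrite // eq_sym.
move/exists_inPn => hB.
have [|] := boolP [exists a in A, exists b in B, b < a]%N.
  case/exists_inP => a aA /exists_inP[b bB ba].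
  have := hB b bB; have := hA a aA; rewrite -!leqNgt => le1 le2.
  have ab : (a0 < b)%N by have := ne _ _ _ _ AP BP AB a0A bB; lia.
  by apply: (nested_hulls AP BP AB a0A aA bB).
move/exists_inPn => h.
have lt a b : a \in A -> b \in B -> (a < b)%N.
  move=> aA bB; have := exists_inPn (h a aA) b bB.
  by have := ne _ _ _ _ AP BP AB aA bB; lia.
case: (@arg_maxnP _ a0 (fun j => j \in A) (@nat_of_ord n) a0A) => m mA mmax.
apply: (separated_hulls (al := (nat_of_ord m)%:R) (be := -1) (ga := 0)) => x xX;
  rewrite mul0r addr0 mulN1r.
  by rewrite subr_ge0 ler_nat; apply: mmax.
by rewrite subr_lt0 ltr_nat; apply: lt.
Qed.

Lemma noncrossing_riordan : (forall B, B \in P -> (1 < #|B|)%N) ->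
  riordan_partition R P.
Proof. by move=> cP; split=> // A B; apply: disjoint_hulls. Qed.

End Noncrossing.
End CircleHulls.

(** * Removing internal edges from Riordan trees *)

Section CutTrees.
Variables (n : nat) (P : {set {set 'I_n}}).
Hypothesis hP : finset.partition P [set: 'I_n].
Implicit Types (E : graph n) (i j a b : 'I_n).

Lemma mem_zip_behead (l : seq 'I_n) a b :
  sorted (fun i j : 'I_n => (i < j)%N) l -> uniq l ->
  ((a, b) \in zip l (behead l)) = [&& a \in l, b == next l a & (a < b)%N].
Proof.
case: l => [|x p] // sl ul; rewrite [behead _]/=.
have zE : rcons (zip (x :: p) p) (last x p, x) =
    [seq (z, next (x :: p) z) | z <- x :: p].
  rewrite zip_next // {2}lastI zip_rcons ?size_belast //; congr rcons.
  by elim: (p) (x) => //= y r IHr z; rewrite -IHr.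
have lt c d : (c, d) \in zip (x :: p) p -> (c < d)%N.
  elim: (p) (x) sl => [|y r IHr] z //= /andP[zy sr].
  by rewrite inE => /predU1P[[-> ->]//|]; apply: IHr.
apply/idP/and3P => [ab|[al /eqP eb ab]].
  have : (a, b) \in rcons (zip (x :: p) p) (last x p, x).
    by rewrite mem_rcons inE ab orbT.
  by move: (lt _ _ ab); rewrite zE => ltab /mapP[z zl [ez eb]]; rewrite eb ez in ltab *.
have : (a, b) \in rcons (zip (x :: p) p) (last x p, x).
  by rewrite zE eb; apply: map_f.
rewrite mem_rcons inE => /predU1P[[ea ebx]|//].
move: ab; rewrite ea ebx ltnNge.
have := mem_last x p; rewrite inE => /predU1P[->|lp]; first by rewrite leqnn.
have := order_path_min (fun _ _ _ => @ltn_trans _ _ _) sl.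
by move=> /allP/(_ _ lp)/ltnW->.
Qed.

Definition tree : graph n := \bigcup_(B in P) linear_tree B.

(** The vertex of the path of its component to which the label [j] belongs. *)
Definition spine_vertex j : vertex n :=
  if j \in middle (pblock P j) then inr j else inl j.

Definition edge_after j : {set vertex n} :=
  [set spine_vertex j; spine_vertex (nxt P j)].

Lemma treeP e : reflect
  ((exists2 a : 'I_n, (a < nxt P a)%N & e = edge_after a) \/
   (exists2 j : 'I_n, j \in middle (pblock P j) & e = [set inl j; inr j]))
  (e \in tree).
Proof.
have tP : finset.trivIset P by case/and3P: hP.
have inP j : pblock P j \in P by rewrite pblock_mem // (cover_partition hP) inE.
pose g B j : vertex n := if j \in middle B then inr j else inl j.
have zE B : zip (spine B) (behead (spine B)) =
    [seq (g B p.1, g B p.2) | p <- zip (enum B) (behead (enum B))].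
  rewrite /spine; case: (enum B) => //= x p.
  by elim: p x => //= y p IHp x; rewrite IHp.
apply: (iffP bigcupP) => [[B BP]|[[a an ->]|[j jm ->]]].
- rewrite inE => /orP[|/imsetP[j jB ->]].
    rewrite inE zE -map_comp => /mapP[[a b] /=].
    rewrite mem_zip_behead ?sorted_enum ?enum_uniq // mem_enum.
    case/and3P=> aB /eqP -> ab ->; left; exists a.
      by rewrite /nxt (def_pblock tP BP aB).
    rewrite /edge_after /spine_vertex pb_nxt // (def_pblock tP BP aB).
    by rewrite /nxt (def_pblock tP BP aB).
  right; exists j => //; rewrite (def_pblock tP BP _) //.
  by move: jB; rewrite inE => /andP[].
- exists (pblock P a) => //; rewrite inE; apply/orP; left.
  rewrite inE zE -map_comp; apply/mapP; exists (a, nxt P a).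
    by rewrite mem_zip_behead ?sorted_enum ?enum_uniq // mem_enum mem_pb // eqxx.
  by rewrite /edge_after /spine_vertex pb_nxt.
exists (pblock P j) => //; rewrite inE; apply/orP; right.
by apply/imsetP; exists j.
Qed.

Variable E : graph n.
Hypothesis hE : E \subset internal_edges tree.

(** Two labels of a part remain connected when no edge between them on the path
    is removed. *)
Definition uncut i j : bool :=
  (j \in pblock P i) &&
  [forall a : 'I_n, (a \in pblock P i) && (minn i j <= a < maxn i j)%N ==>
     (edge_after a \notin E)].

Lemma uncutP i j : (i <= j)%N -> reflect
  (j \in pblock P i /\
   forall a, a \in pblock P i -> (i <= a < j)%N -> edge_after a \notin E)
  (uncut i j).
Proof.
move=> ij; rewrite /uncut (minn_idPl ij) (maxn_idPr ij).
apply: (iffP andP) => [[-> /forallP h]|[-> h]]; split=> //.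
  by move=> a ai ia; have /implyP := h a; rewrite ai ia; apply.
by apply/forallP => a; apply/implyP => /andP[ai ia]; apply: h.
Qed.

Lemma uncut_refl i : uncut i i.
Proof.
by apply/(uncutP (leqnn i)); split=> [|a _]; [apply: mem_pb | lia].
Qed.

Lemma uncut_sym i j : uncut i j = uncut j i.
Proof.
rewrite /uncut pb_sym // minnC maxnC; case: (boolP (i \in _)) => //=.
by rewrite pb_eq // => /eqP->.
Qed.

Lemma uncut_trans i j l : uncut i j -> uncut j l -> uncut i l.
Proof.
rewrite /uncut !pb_eq // => /andP[/eqP-> /forallP h1] /andP[/eqP e /forallP h2].
rewrite e eqxx; apply/forallP => a; apply/implyP => /andP[al hl].
have := h1 a; have := h2 a; rewrite e al /=.
have [//|ni h _] := boolP (minn i j <= a < maxn i j)%N.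
by move/implyP: h; apply; lia.
Qed.

Lemma uncut_equiv : {in [set: 'I_n] & &, equivalence_rel uncut}.
Proof.
move=> i j l _ _ _; split=> [|ij]; first exact: uncut_refl.
apply/idP/idP; first by apply: uncut_trans; rewrite uncut_sym.
exact: uncut_trans.
Qed.

Lemma uncut_nxt a : (a < nxt P a)%N -> edge_after a \notin E -> uncut a (nxt P a).
Proof.
move=> an ne; apply/(uncutP (ltnW an)); split=> [|b ba hb]; first exact: nxt_in.
rewrite (_ : b = a) //; apply: val_inj => /=.
by have := nxt_max hP an ba; lia.
Qed.

Definition label (x : vertex n) : 'I_n :=
  match x with inl j => j | inr j => j end.

Lemma label_spine j : label (spine_vertex j) = j.
Proof. by rewrite /spine_vertex; case: ifP. Qed.

Lemma adj_uncut x y : adj (tree :\: E) x y -> uncut (label x) (label y).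
Proof.
rewrite /adj inE => /andP[nE /treeP[[a an e]|[j _ e]]].
  have hl z : z \in [set x; y] -> label z = a \/ label z = nxt P a.
    by rewrite e !inE => /orP[]/eqP->; rewrite label_spine; [left|right].
  have ua : uncut a (nxt P a) by apply: uncut_nxt => //; rewrite -e.
  case: (hl x) => [|->|->]; first by rewrite !inE eqxx.
    case: (hl y) => [|->|->] //; first by rewrite !inE eqxx orbT.
    exact: uncut_refl.
  case: (hl y) => [|->|->]; first by rewrite !inE eqxx orbT.
    by rewrite uncut_sym.
  exact: uncut_refl.
have hl z : z \in [set x; y] -> label z = j.
  by rewrite e !inE => /orP[]/eqP->.
rewrite !hl ?uncut_refl // !inE eqxx ?orbT //.
Qed.

Lemma connect_uncut x y : connect (adj (tree :\: E)) x y ->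
  uncut (label x) (label y).
Proof.
case/connectP=> p; elim: p x => [|z p IHp] x /=; first by move=> _ ->; apply: uncut_refl.
by case/andP=> xz pz ey; apply: uncut_trans (adj_uncut xz) (IHp _ pz ey).
Qed.

Lemma adj_sym : symmetric (adj (tree :\: E)).
Proof. by move=> x y; rewrite /adj finset.setUC. Qed.

Lemma leg_connect j : connect (adj (tree :\: E)) (inl j) (spine_vertex j).
Proof.
rewrite /spine_vertex; case: ifP => jm; last exact: connect0.
apply: connect1; rewrite /adj inE; apply/andP; split; last first.
  by apply/treeP; right; exists j.
apply/negP => /(subsetP hE); rewrite inE => /andP[_ /subsetP/(_ (inl j))].
by rewrite !inE eqxx => /(_ isT)/imsetP[].
Qed.

(** One walks along the path from one label to the next; the legs are still
    there, as they are not internal edges. *)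
Lemma uncut_connect i j : uncut i j ->
  connect (adj (tree :\: E)) (inl i) (inl j).
Proof.
have csym := sym_connect_sym adj_sym.
wlog ij : i j / (i <= j)%N.
  move=> h; case: (leqP i j) => [|/ltnW] ij; first exact: h.
  by rewrite csym uncut_sym; apply: h.
move: {2}(j - i)%N (leqnn (j - i)) => d; elim: d i ij => [|d IHd] i ij dij u.
  by rewrite (_ : i = j) ?connect0 //; apply: val_inj => /=; lia.
have [->|ne] := eqVneq i j; first exact: connect0.
have ij' : (i < j)%N by rewrite ltn_neqAle (inj_eq val_inj) ne.
have /(uncutP ij)[jb cut] := u.
have ii : (i < nxt P i)%N by rewrite nxt_gtE //; apply/exists_inP; exists j.
have nj : (nxt P i <= j)%N by have := nxt_max hP ii jb; lia.
apply: (connect_trans (leg_connect i)).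
have step : adj (tree :\: E) (spine_vertex i) (spine_vertex (nxt P i)).
  rewrite /adj -/(edge_after i) inE cut ?mem_pb ?leqnn //.
  by apply/treeP; left; exists i.
apply: (connect_trans (connect1 step)).
have := leg_connect (nxt P i); rewrite csym => h; apply: (connect_trans h).
apply: IHd => //; first by lia.
apply: uncut_trans u; rewrite uncut_sym; apply: uncut_nxt => //.
by apply: cut; rewrite ?mem_pb ?leqnn.
Qed.

Lemma connect_labels i j :
  connect (adj (tree :\: E)) (inl i) (inl j) = uncut i j.
Proof.
by apply/idP/idP => [/connect_uncut//|]; apply: uncut_connect.
Qed.

Local Notation PE := (label_partition (tree :\: E)).

Lemma label_partitionE : PE = equivalence_partition uncut [set: 'I_n].
Proof.
by congr equivalence_partition; apply/funext => i; apply/funext => j;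
  apply: connect_labels.
Qed.

Lemma cut_partition : finset.partition PE [set: 'I_n].
Proof. by rewrite label_partitionE; apply/equivalence_partitionP/uncut_equiv. Qed.

Lemma mem_cut i j : (j \in pblock PE i) = uncut i j.
Proof. by rewrite label_partitionE pblock_equivalence_partition //; apply: uncut_equiv. Qed.

Lemma cut_noncrossing : noncrossing P -> noncrossing PE.
Proof.
move=> ncP a b c d ab bc cd; rewrite !mem_cut.
move=> /(uncutP (ltnW (ltn_trans ab bc)))[ac cut].
move=> /(uncutP (ltnW (ltn_trans bc cd)))[bd _].
apply/(uncutP (ltnW ab)); split; first exact: ncP ab bc cd ac bd.
by move=> x xa hx; apply: cut => //; lia.
Qed.

(** Each part is cut into intervals, hence a larger successor in a piece is also
    the successor in the whole part. *)
Lemma nxt_cut j : (j < nxt PE j)%N -> nxt PE j = nxt P j.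
Proof.
move=> jn; have := nxt_in cut_partition j; rewrite mem_cut.
move=> /(uncutP (ltnW jn))[jb cut].
have jn' : (j < nxt P j)%N by rewrite nxt_gtE //; apply/exists_inP; exists (nxt PE j).
have := nxt_max hP jn' jb => le.
have : nxt P j \in pblock PE j.
  rewrite mem_cut; apply: uncut_nxt => //.
  by apply: cut; rewrite ?mem_pb // leqnn jn.
move/(nxt_max cut_partition jn) => le'; apply: val_inj => /=; lia.
Qed.

Lemma open_blocks_cut l : (open_blocks PE l <= open_blocks P l)%N.
Proof.
apply/subset_leq_card/subsetP => j; rewrite !inE => h.
by rewrite -nxt_cut //; lia.
Qed.

(** At a gap between the two labels joined by a removed edge, their part in [P] is
    open, while all parts obtained from it are closed. *)
Lemma open_blocks_cut_lt : E != finset.set0 ->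
  exists l, (open_blocks PE l < open_blocks P l)%N.
Proof.
case/set0Pn=> e eE; have := subsetP hE e eE; rewrite inE => /andP[/treeP[|[j _ ej]]].
  case=> a an ea _; exists (nxt P a); apply/proper_card/properP; split.
    by apply/subsetP => j; rewrite !inE => h; rewrite -(@nxt_cut j) //; lia.
  exists a; rewrite inE ?an ?leqnn //; apply/negP => /andP[_ h].
  have aE : (a < nxt PE a)%N by lia.
  have := nxt_in cut_partition a; rewrite mem_cut.
  case/(uncutP (ltnW aE)) => _ /(_ a (mem_pb hP a)).
  by rewrite leqnn aE -ea eE => /(_ isT).
by move/subsetP/(_ (inl j)); rewrite ej !inE eqxx => /(_ isT)/imsetP[].
Qed.

End CutTrees.

Lemma label_partition_tree n (P : {set {set 'I_n}}) :
  finset.partition P [set: 'I_n] -> label_partition (tree P :\: finset.set0) = P.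
Proof.
move=> hP; rewrite (label_partitionE hP) ?sub0set //.
rewrite -[RHS](equivalence_partition_pblock hP); congr equivalence_partition.
apply/funext => i; apply/funext => j; rewrite /uncut.
case: (j \in _) => //=; apply/forallP => a; rewrite inE; exact: implybT.
Qed.

(** * Bases from triangular families *)

Section TriangularBasis.
Variables (k : fieldType) (I : finType) (G : {set I}) (mu : I -> nat).
Variables (v : I -> {ffun I -> k^o}) (S : {ffun I -> k^o} -> Prop).
Hypothesis v_diag : forall t, t \in G -> v t t != 0.
Hypothesis v_tri : forall t u, t \in G -> u \in G -> v t u != 0 ->
  u = t \/ (mu u < mu t)%N.
Hypothesis S0 : S 0.
Hypothesis S_lin : forall c x y, S x -> S y -> S (c *: x + y).
Hypothesis S_v : forall t, t \in G -> S (v t).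
Hypothesis S_inj : forall x, S x -> (forall t, t \in G -> x t = 0) -> x = 0.

Let X := image_tuple v G.

Lemma triangular_free : free X.
Proof.
apply/freeP => c c0 i; apply/eqP/negPn/negP => ci.
case: (@arg_maxnP _ i (fun j => c j != 0) (fun j => mu (enum_val j)) ci) => j cj jmax.
have /ffunP/(_ (enum_val j)) := c0; rewrite sum_ffunE ffunE (bigD1 j) //=.
rewrite big1 => [|h hj].
  rewrite addr0 nth_image ffunE => /eqP; rewrite mulf_eq0 (negPf cj) /=.
  by rewrite (negPf (v_diag (enum_valP j))).
rewrite nth_image ffunE; apply/eqP/negPn/negP.
rewrite mulf_eq0 negb_or => /andP[ch vh].
case: (v_tri (enum_valP h) (enum_valP j) vh) => [/enum_val_inj e|].
  by rewrite e eqxx in hj.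
by have := jmax h ch => /=; lia.
Qed.

(** Gaussian elimination, starting from the largest value of [mu]. *)
Lemma triangular_elim N (x : {ffun I -> k^o}) :
  (forall t, t \in G -> x t != 0 -> (mu t < N)%N) ->
  exists2 y, y \in <<X>>%VS & forall t, t \in G -> x t = y t.
Proof.
have vX t : t \in G -> v t \in <<X>>%VS.
  by move=> tG; apply: memv_span; apply: image_f.
elim: N x => [|N IHN] x xN.
  exists 0; first exact: mem0v.
  move=> t tG; rewrite ffunE; apply/eqP/negPn/negP => /(xN t tG).
  by rewrite ltn0.
pose y0 : {ffun I -> k^o} := \sum_(t in [set t in G | mu t == N]) (x t / v t t) *: v t.
have y0X : y0 \in <<X>>%VS.
  by apply: memv_suml => t; rewrite inE => /andP[tG _]; apply/memvZ/vX.
have y0E t : y0 t = \sum_(u in [set t in G | mu t == N]) (x u / v u u) * v u t.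
  by rewrite sum_ffunE; apply: eq_bigr => u _; rewrite ffunE.
have [|y yX hy] := IHN (x - y0).
  move=> t tG; rewrite !ffunE y0E => h; rewrite ltnNge; apply/negP => Nt.
  case/negP: h; apply/eqP; have [tN|tN] := eqVneq (mu t) N.
    rewrite (bigD1 t) ?inE ?tG ?tN ?eqxx //= divfK ?v_diag // big1 ?addr0 ?subrr //.
    move=> u /andP[]; rewrite inE => /andP[uG /eqP uN] ut.
    have [->|vut] := eqVneq (v u t) 0; first by rewrite mulr0.
    by case: (v_tri uG tG vut) => [e|]; [rewrite e eqxx in ut | rewrite uN tN ltnn].
  have -> : x t = 0.
    by apply/eqP/negPn/negP => /(xN t tG); lia.
  rewrite big1 ?subrr // => u; rewrite inE => /andP[uG /eqP uN].
  have [->|vut] := eqVneq (v u t) 0; first by rewrite mulr0.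
  by case: (v_tri uG tG vut) => [e|]; [move: tN; rewrite e uN eqxx | lia].
exists (y + y0); first exact: memvD.
by move=> t tG; rewrite ffunE -hy // !ffunE subrK.
Qed.

Lemma triangular_span_sub x : x \in <<X>>%VS -> S x.
Proof.
move=> xX; rewrite (coord_span xX).
elim/big_rec: _ => [|i y _ Sy]; first exact: S0.
by apply: S_lin => //; rewrite nth_image; apply/S_v/enum_valP.
Qed.

(** An element of [S] agrees on [G] with an element of the span, and their
    difference lies in [S], hence vanishes. *)
Lemma triangular_basis : is_basis [set` [seq v t | t in G]]%classic S.
Proof.
exists X; first exact: triangular_free.
split=> //; apply/seteqP; split=> x /=; first exact: triangular_span_sub.
move=> Sx; have [|y yX hy] := @triangular_elim (\max_t mu t).+1 x.
  by move=> t _ _; rewrite ltnS; apply: leq_bigmax.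
suff -> : x = y by [].
apply/eqP; rewrite -subr_eq0; apply/eqP/S_inj => [|t tG].
  by rewrite addrC -scaleN1r; apply: S_lin => //; apply: triangular_span_sub.
by rewrite !ffunE hy // subrr.
Qed.
End TriangularBasis.

(** * The elements f(T) *)

Section TreeElements.
Variables (k : fieldType) (q : k).
Hypothesis q0 : q != 0.
Hypothesis q_nonroot : forall m, (0 < m)%N -> q ^+ m != 1.
Variable n : nat.

Lemma Inv_lin c (x y : tens k 2 n) : Inv q n x -> Inv q n y -> Inv q n (c *: x + y).
Proof.
move=> /(InvP q0 q_nonroot)[Ex hx] /(InvP q0 q_nonroot)[Ey hy].
apply/(InvP q0 q_nonroot); split; first by rewrite actE_lin Ex Ey scaler0 addr0.
move: hx hy; rewrite /homog actKD // actKZ // => -> ->.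
by rewrite scalerDr !scalerA mulrC.
Qed.

Lemma Inv0 : Inv q n 0.
Proof.
apply/(InvP q0 q_nonroot); split; first exact: actE0.
by apply/homogP => // t; rewrite ffunE eqxx.
Qed.

Lemma f0_Inv (P : {set {set 'I_n}}) : finset.partition P [set: 'I_n] ->
  noncrossing P -> Inv q n (f0 q P).
Proof.
move=> hP ncP; apply/(InvP q0 q_nonroot); split; last exact: f0_homog.
by rewrite /f0 actE_pi2 // actE_uP // pi2_tens0.
Qed.

Variable P : {set {set 'I_n}}.
Hypothesis hP : finset.partition P [set: 'I_n].
Hypothesis ncP : noncrossing P.

Lemma f_tree_Inv : Inv q n (f q (tree P)).
Proof.
rewrite /f; elim/big_rec: _ => [|E x]; first exact: Inv0.
rewrite powersetE => hE Ix; apply: Inv_lin => //.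
by apply: f0_Inv; [apply: cut_partition | apply: cut_noncrossing].
Qed.

Lemma f_tree_le t l : f q (tree P) t != 0 ->
  ht (drop l t) <= ht (drop l (word P)).
Proof.
rewrite /f sum_ffunE => ft; have [E hE] : exists2 E : graph n,
    E \in powerset (internal_edges (tree P)) &
    f0 q (label_partition (tree P :\: E)) t != 0.
  apply/exists_inP; apply: contraR ft => /exists_inPn h.
  rewrite big1 // => E hE; rewrite ffunE; have := h E hE.
  by rewrite negbK => /eqP->; rewrite scaler0.
rewrite powersetE in hE => /(f0_le q0 q_nonroot (cut_partition hP hE) l) h.
apply: le_trans h _; rewrite !ht_word //; last exact: cut_partition.
by rewrite lez_nat open_blocks_cut.
Qed.

Hypothesis cardP : forall B, B \in P -> (1 < #|B|)%N.

(** Removing edges strictly lowers the leading word, so that only the term with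
    no edge removed contributes to the leading coefficient. *)
Lemma f_tree_word : f q (tree P) (word P) != 0.
Proof.
rewrite /f sum_ffunE (bigD1 finset.set0) ?powersetE ?sub0set //=.
rewrite big1 ?addr0 => [|E /andP[]].
  rewrite ffunE cards0 expr0 invr1 scale1r label_partition_tree //.
  by apply: f0_word => // j; apply: nxt_neq.
rewrite powersetE => hE E0; rewrite ffunE.
have [->|h] := eqVneq (f0 q (label_partition (tree P :\: E)) (word P)) 0.
  by rewrite scaler0.
have [l] := open_blocks_cut_lt hP hE E0.
have := f0_le q0 q_nonroot (cut_partition hP hE) l h.
rewrite !ht_word //; last exact: cut_partition.
by rewrite lez_nat leqNgt => /negbTE->.
Qed.

End TreeElements.

Section RiordanWords.
Variable n : nat.

(** The words of the Riordan partitions. *)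
Definition riordan_words : {set n.-tuple 'I_3} :=
  [set t : n.-tuple 'I_3 | good t && (ht t == 0)].

(** The sum of the heights, which turns the pointwise order of the height
    functions into a ranking. *)
Definition area (t : n.-tuple 'I_3) : nat := \sum_(l < n) `|ht (drop l t)|%N.

Lemma area_lt (t u : n.-tuple 'I_3) : t \in riordan_words ->
  u \in riordan_words ->
  (forall l, ht (drop l u) <= ht (drop l t)) -> u = t \/ (area u < area t)%N.
Proof.
rewrite !inE => /andP[gt _] /andP[gu _] le; have [->|ne] := eqVneq u t; first by left.
right; have ge0 l := good_ht_ge0 (good_drop l gu).
have [|] := boolP [forall l : 'I_n, ht (drop l u) == ht (drop l t)].
  move/forallP => e; case/eqP: ne; apply: eq_from_tnth => j; apply: val_inj => /=.
  have eS : ht (drop j.+1 u) = ht (drop j.+1 t).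
    have := ltn_ord j; rewrite leq_eqVlt => /predU1P[->|jn].
      by rewrite !drop_oversize ?size_tuple.
    exact: eqP (e (Ordinal jn)).
  have /eqP := e j; rewrite !ht_drop_step eS; lia.
rewrite negb_forall => /existsP[l hl]; rewrite /area (bigD1 l) //=.
rewrite [X in (_ < X)%N](bigD1 l) //= -addSn leq_add //.
  by have := le l; have := ge0 l; move: hl; lia.
by apply: leq_sum => m _; have := le m; have := ge0 m; lia.
Qed.

End RiordanWords.

Lemma qvar_neq0 (R : realType) : qvar R != 0.
Proof. by rewrite tofrac_eq0 polyX_eq0. Qed.

Lemma qvar_nonroot (R : realType) m : (0 < m)%N -> qvar R ^+ m != 1.
Proof.
move=> m0; rewrite -tofracXn -tofrac1 tofrac_eq.
apply/eqP => /(congr1 (fun p : {poly R[i]} => size p)).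
by rewrite size_polyXn size_poly1; lia.
Qed.

Theorem theorem4p3 (R : realType) (n : nat) (hn : (0 < n)%N) :
  is_basis (BJW R n) (Inv (qvar R) n).
Proof.
have q0 := @qvar_neq0 R; have q1 := @qvar_nonroot R.
set q := qvar R in q0 q1 *.
pose v (t : n.-tuple 'I_3) := f q (tree (partition_of t)).
have wP t : t \in riordan_words n -> word (partition_of t) = t.
  by rewrite inE => /andP[gt /eqP ht0]; apply: word_partition_of.
have cP t : t \in riordan_words n ->
    forall B, B \in partition_of t -> (1 < #|B|)%N.
  by rewrite inE => /andP[gt /eqP ht0] B; apply: card_partition_of.
have pP := @partition_of_partition n; have nP := @partition_of_noncrossing n.
have -> : BJW R n = [set` [seq v t | t in riordan_words n]]%classic.
  apply/seteqP; split=> x /=.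
    case=> T [P rP ->] <-; have nc := riordan_noncrossing rP.
    case: rP => hP hc _; apply/imageP; exists (word P).
      by rewrite inE good_word // ht_word0.
    by rewrite /v partition_of_word.
  case/imageP=> t tG ->; exists (tree (partition_of t)) => //.
  by exists (partition_of t) => //; apply: noncrossing_riordan => //; apply: cP.
apply: (@triangular_basis _ _ _ (@area n)).
- by move=> t tG; have := f_tree_word q0 q1 (pP t) (cP t tG); rewrite wP.
- move=> t u tG uG vtu; apply: area_lt => // l.
  by have := f_tree_le q0 q1 (pP t) l vtu; rewrite wP.
- exact: Inv0.
- exact: Inv_lin.
- by move=> t tG; apply: f_tree_Inv.
move=> x /(InvP q0 q1)[Ex hx] x0; apply: (highest_eq0 q0 q1 hx Ex) => t gt.
have [ht0|ht0] := eqVneq (ht t) 0; first by apply: x0; rewrite inE gt ht0 eqxx.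
by apply/eqP/negPn/negP => xt; case/eqP: ht0; move/(homogP q0 q1): hx; apply.
Qed.
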